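(* Let $\mathcal{D}$ be a distribution on $\mathcal{X}$, $X\sim\mathcal{D}^n$, $k\ge1$, $\rho>0$. Consider $k$ rounds in which an arbitrary (possibly randomized) analyst chooses statistical queries $\phi_i:\mathcal{X}\to[0,1]$ as functions of previous answers $a_1,\dots,a_{i-1}$, and the Gaussian mechanism answers $a_i=\phi_i(X)+Z_i$ with $Z_1,\dots,Z_k$ i.i.d. $N\!\left(0,\frac{1}{2n^2\rho}\right)$. Then $$\mathbb{E}\left[\max_{i\in[k]}(\phi_i(\mathcal{D})-a_i)^2\right]\le\frac{1}{2n}\inf_{\lambda\in(0,1)}\left(\frac{2\rho kn-\ln(1-\lambda)}{\lambda}\right)+2\,\mathbb{E}_{Z_i\sim N(0,\frac{1}{2n^2\rho})\text{ i.i.d.}}\left[\max_{i\in[k]}Z_i^2\right].$$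
   Context: For a statistical query $\phi$, $\phi(X)=\frac1n\sum_j\phi(x_j)$ and $\phi(\mathcal{D})=\mathbb{E}_{x\sim\mathcal{D}}\phi(x)$. The expectation on the left is over $X$, the mechanism's noise and the analyst's randomness. *)

(* Defs.v *)
From HB Require Import structures.
From mathcomp Require Import all_boot all_order all_algebra.
From mathcomp Require Import all_classical all_reals all_analysis.
Set Implicit Arguments. Unset Strict Implicit. Unset Printing Implicit Defensive.
Import Order.TTheory GRing.Theory Num.Theory.
Local Open Scope classical_set_scope.
Local Open Scope ring_scope.

Section adaptive.
Context {R : realType} {dO dT dS : measure_display}
  {Omega : measurableType dO} {T : measurableType dT} {S : measurableType dS}.

Definition empmean {n : nat} (phi : T -> R) (X : 'I_n -> T) : R :=
  n%:R^-1 * \sum_(j < n) phi (X j).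

Definition popmean (D : probability T R) (phi : T -> R) : R :=
  fine (\int[D]_t (phi t)%:E)%E.

Variables (n : nat) (analyst : forall i : nat, S -> i.-tuple R -> T -> R)
  (X : 'I_n -> Omega -> T) (Z : nat -> Omega -> R) (U : Omega -> S).

(* transcript of the first i answers, a_1..a_i;
   round i (0-based) query: analyst i (U w) (answers so far);
   answer: empirical mean of the query on the data plus noise Z i *)
Fixpoint transcript (i : nat) : Omega -> i.-tuple R :=
  match i with
  | 0 => fun _ => [tuple]
  | i'.+1 => fun w =>
      let h := transcript i' w in
      rcons_tuple h (empmean (@analyst i' (U w) h) (fun j => X j w) + Z i' w)
  end.

Definition query (i : nat) (w : Omega) : T -> R := @analyst i (U w) (transcript i w).

Definition answer (i : nat) (w : Omega) : R :=
  empmean (query i w) (fun j => X j w) + Z i w.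

End adaptive.

(* mutual independence of the n data points, the k noise variables and the
   analyst's randomness: product rule on all measurable rectangles *)
Definition mutually_independent {R : realType} {dO dT dS : measure_display}
  {Omega : measurableType dO} {T : measurableType dT} {S : measurableType dS}
  (P : probability Omega R) (n k : nat)
  (X : 'I_n -> Omega -> T) (Z : nat -> Omega -> R) (U : Omega -> S) : Prop :=
  forall (A : 'I_n -> set T) (B : 'I_k -> set R) (C : set S),
    (forall j, measurable (A j)) -> (forall i, measurable (B i)) -> measurable C ->
    P ((\bigcap_(j in [set: 'I_n]) (X j @^-1` A j))
       `&` (\bigcap_(i in [set: 'I_k]) (Z i @^-1` B i)) `&` (U @^-1` C))
    = ((\prod_(j < n) P (X j @^-1` A j)) * (\prod_(i < k) P (Z i @^-1` B i))
       * P (U @^-1` C))%E.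

(* Main.v *)
Require Import Defs.
From HB Require Import structures.
From mathcomp Require Import all_boot all_order all_algebra.
From mathcomp Require Import all_classical all_reals all_analysis.
From mathcomp Require Import measurable_realfun ring lra.
Import Order.TTheory GRing.Theory Num.Theory.
Import numFieldNormedType.Exports.
Local Open Scope classical_set_scope.
Local Open Scope ring_scope.

(** The round [i] maximizing [(phi_i(D) - a_i)^2] is a function of the answers
    and of the analyst's randomness [u] only, and
    [(phi_i(D) - a_i)^2 <= 2 (phi_i(D) - phi_i(X))^2 + 2 Z_i^2], so it suffices
    to bound the expected squared gap [G(X, a)] of the selected query.

    Relative to pure Gaussian noise, the answers have a density [L(x, a)] that is
    an explicit product of Gaussian shifts.  For fixed [u] and [a]:
    - the Donsker-Varadhan inequality gives
      [E_X (L f) <= Ent_X L + E_X L * ln (E_X (exp f))] for [f = 2 n l G];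
    - the selected query no longer depends on [X], so Hoeffding's lemma gives
      [E_X (exp f) <= (1 - l)^(-1/2)];
    - entropy is subadditive over the independent coordinates of [X], and Jensen
      bounds each coordinate's share by the divergence between [L] and [L] with
      that data point resampled.
    Integrating over [a], each of the [n] coordinates contributes the divergence
    between two adaptive Gaussian transcripts whose means differ by at most [1/n]
    in each round, i.e. at most [k rho].

    The divergence is used in the form [x ln (x / y) - x + y], which is
    nonnegative, so that Tonelli's theorem applies without integrability
    conditions. *)

(** * Hoeffding's two-point inequality *)

(** The obstacle is adaptivity: the selected query depends on the data through the answers, so
    concentration for a fixed query cannot be applied under the joint law. Taking pure noise as
    reference law for the answers moves all of this dependence into the weight [L]. The price is
    that [L(., a)] has no reason to be normalized in the data, so entropies carry the mean of [L]
    along. These means integrate to 1 over [a], which gives the logarithm of the moment bound the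
    coefficient 1. The exponent [2 n l G] equals [l c^2 / 2] for [c = 2 sqrt(n) (phi(D) - phi(X))],
    which Hoeffding makes subgaussian with variance proxy 1; and [(1 - l)^(-1/2)] is the mean of
    [exp (l g^2 / 2)] for a standard Gaussian [g]. A mean shift of [1/n] costs
    [(1/n)^2 / (2 s^2) = rho] per round when [s^2 = 1 / (2 n^2 rho)]. Hence [E[2 n l G] <= n k rho -
    ln (1 - l) / 2], and division by [n l] gives the stated bound on [2 E[G]]. *)

Section real_inequalities.
Context {R : realType}.
Implicit Types x y s p : R.

Definition kl x y : R := x * (ln x - ln y) - x + y.

Lemma ln_le_subr1 x : 0 < x -> ln x <= x - 1.
Proof.
move=> x0; rewrite -[x in leRHS]lnK ?posrE//.
have := @expR_ge1Dx R (ln x); lra.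
Qed.

Lemma kl_ge0 x y : 0 < x -> 0 < y -> 0 <= kl x y.
Proof.
move=> x0 y0; rewrite /kl.
have yx0 : 0 < y / x by rewrite divr_gt0.
have := ln_le_subr1 _ yx0; rewrite ln_div ?posrE// => H.
have : x * (ln y - ln x) <= x * (y / x - 1) by rewrite ler_pM2l.
have -> : x * (y / x - 1) = y - x by field; rewrite gt_eqF.
lra.
Qed.

Lemma derive_le0_le_at0 (f df : R -> R) x :
  (forall z, is_derive z (1 : R) f (df z)) ->
  (forall z, 0 <= z -> df z <= 0) -> 0 <= x -> f x <= f 0.
Proof.
move=> fd df0 x0.
have cf : {within `[0, x], continuous f}.
  apply: derivable_within_continuous => z _.
  by have [] := fd z.
have [c] := @MVT_segment R f df 0 x x0 (fun z _ => fd z) cf.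
rewrite in_itv/= => /andP[c0 _] E; rewrite -subr_le0 E subr0.
by rewrite mulr_le0_ge0// df0.
Qed.

(** This is [tanh x <= x] with the denominator cleared, the form in which the next lemma uses it. *)
Lemma expR_sub1_le x : 0 <= x -> expR (2 * x) - 1 <= x * (expR (2 * x) + 1).
Proof.
move=> x0.
pose f (z : R) := expR (2 * z) - 1 - z * (expR (2 * z) + 1).
have := @derive_le0_le_at0 f (fun z =>
  2 * expR (2 * z) - (expR (2 * z) + 1 + z * (2 * expR (2 * z)))) x.
rewrite /f mulr0 expR0 mul0r => H.
suff : expR (2 * x) - 1 - x * (expR (2 * x) + 1) <= 1 - 1 - 0 by lra.
apply: H => // [z|z z0].
  apply: is_derive_eq.
  rewrite /GRing.scale/=; ring.
(* The derivative is [(1 - 2 z) exp (2 z) - 1], and [1 - 2 z <= exp (- 2 z)] makes it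
   nonpositive. *)
have := @expR_ge1Dx R (- (2 * z)).
have e0 := expR_gt0 (2 * z).
rewrite expRN => H1.
have : (1 - 2 * z) * expR (2 * z) <= 1.
  rewrite -[leRHS](mulVf (lt0r_neq0 e0)) ler_pM2r//; lra.
lra.
Qed.

(** Replaces the usual bound 1/4 on the second derivative of the Bernoulli log moment generating
    function by a bound on its first derivative. With [r = exp (s / 2)], the excess of that
    derivative over [p] is [p (1 - p) (r^2 - 1) / (1 - p + p r^2)], at most [(r - 1) / (r + 1) =
    tanh (s / 4) <= s / 4]. *)
Lemma hoeffding_slope p s : 0 <= p <= 1 -> 0 <= s ->
  p * expR s <= (1 - p + p * expR s) * (s / 4 + p).
Proof.
move=> /andP[p0 p1] s0.
have u0 : 0 <= s / 4 by lra.
have := expR_sub1_le _ u0.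
set u := s / 4; set r := expR (2 * u) => tanh.
have Es : expR s = r * r by rewrite /r -expRD; congr expR; rewrite /u; field.
have r1 : 1 <= r by rewrite /r -[leLHS]expR0 ler_expR mulr_ge0.
rewrite Es.
have H1 : (r - 1) * (p * (1 - p) * (r + 1) ^+ 2) <= (r - 1) * (1 - p + p * (r * r)).
  apply: ler_wpM2l; first lra.
  (* The right factor minus the left one is exactly this square. *)
  have := sqr_ge0 (p * r - (1 - p)); lra.
have H2 : (r - 1) * (1 - p + p * (r * r)) <= (u * (r + 1)) * (1 - p + p * (r * r)).
  apply: ler_wpM2r; last exact: tanh.
  by rewrite addr_ge0 ?mulr_ge0//; lra.
have H3 : (r + 1) * (p * (1 - p) * ((r - 1) * (r + 1))) <=
    (r + 1) * (u * (1 - p + p * (r * r))) by lra.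
rewrite ler_pM2l in H3; last lra.
lra.
Qed.

(** The left side equals 1 at [s = 0], and [hoeffding_slope] is the statement that its derivative is
    nonpositive for [s >= 0]. *)
Lemma hoeffding_cgf_ge0 p s : 0 <= p <= 1 -> 0 <= s ->
  (1 - p + p * expR s) * expR (- (s ^+ 2 / 8 + p * s)) <= 1.
Proof.
move=> p01 s0.
pose f (z : R) := (1 - p + p * expR z) * expR (- (z ^+ 2 / 8 + p * z)).
pose df (z : R) := expR (- (z ^+ 2 / 8 + p * z)) *
   (p * expR z - (1 - p + p * expR z) * (z / 4 + p)).
have f0 : f 0 = 1.
  by rewrite /f mulr0 expr0n/= mul0r addr0 oppr0 expR0 !mulr1 subrK.
rewrite -[leRHS]f0; apply: (@derive_le0_le_at0 f df s) => //.
  move=> z; rewrite /f; apply: is_derive_eq.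
  rewrite /df /GRing.scale/=.
  set e1 := expR (- _); set e2 := expR z.
  have -> : z / 4 = z * (2 * 8^-1) by field.
  set c := 8^-1; move: e1 e2 c => e1 e2 c.
  ring.
move=> z z0; rewrite /df mulr_ge0_le0 ?expR_ge0//.
by rewrite subr_le0 hoeffding_slope.
Qed.

Lemma hoeffding_two_point p s : 0 <= p <= 1 ->
  (1 - p + p * expR s) * expR (- (p * s)) <= expR (s ^+ 2 / 8).
Proof.
move=> p01.
have [s0|/ltW s0] := leP 0 s.
  have := hoeffding_cgf_ge0 _ _ p01 s0.
  rewrite opprD expRD mulrCA => H.
  rewrite -(ler_pM2l (expR_gt0 (- (s ^+ 2 / 8)))).
  by rewrite -expRD addNr expR0.
(* Negative [s] reduces to the previous case by exchanging the two outcomes, that is, replacing [p]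
   by [1 - p] and [s] by [- s]. *)
have p01' : 0 <= 1 - p <= 1 by lra.
have s0' : 0 <= - s by lra.
have := hoeffding_cgf_ge0 _ _ p01' s0'.
rewrite sqrrN.
have -> : (1 - (1 - p) + (1 - p) * expR (- s)) * expR (- (s ^+ 2 / 8 + (1 - p) * - s))
   = (p * expR s + (1 - p) * (expR (- s) * expR s)) * (expR (- (p * s)) * expR (- (s ^+ 2 / 8))).
  rewrite (_ : - (s ^+ 2 / 8 + (1 - p) * - s) = s + (- (p * s) + - (s ^+ 2 / 8))); last by ring.
  by rewrite !expRD; ring.
rewrite -expRD addNr expR0 => H.
rewrite -(ler_pM2r (expR_gt0 (- (s ^+ 2 / 8)))).
rewrite -[leRHS]expRD subrr expR0.
by have -> : (1 - p + p * expR s) * expR (- (p * s)) * expR (- (s ^+ 2 / 8)) =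
  (p * expR s + (1 - p) * 1) * (expR (- (p * s)) * expR (- (s ^+ 2 / 8))) by ring.
Qed.

Lemma expR_convex01 s x : 0 <= x <= 1 -> expR (s * x) <= 1 - x + x * expR s.
Proof.
move=> /andP[x0 x1].
(* The chord bound is the average, with weights [x] and [1 - x], of the tangent inequality at
   [s * x] evaluated at [s] and at 0; the first-order terms cancel. *)
have tangent (u v : R) : expR v * (1 + (u - v)) <= expR u.
  have -> : expR u = expR v * expR (u - v) by rewrite -expRD addrC subrK.
  rewrite ler_pM2l ?expR_gt0//; exact: expR_ge1Dx.
have := ler_wpM2l x0 (tangent s (s * x)).
have x1' : 0 <= 1 - x by lra.
have := ler_wpM2l x1' (tangent 0 (s * x)).
rewrite expR0; lra.
Qed.

End real_inequalities.

(** * Gaussian integrals *)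

Lemma integral_cst_probability {R : realType} d (T : measurableType d)
  (P : probability T R) (c : \bar R) : (\int[P]_x c = c)%E.
Proof. by rewrite -[RHS]mule1 -(probability_setT P) -integral_cst. Qed.

Section normal_integrals.
Context {R : realType}.
Implicit Types (m s : R).
Local Notation leb := (@lebesgue_measure R).
Import HBNNSimple.

(** On indicators this is the definition of [normal_prob] by its density; simple functions follow by
    linearity, and monotone convergence on both sides gives the rest. *)
Lemma ge0_integral_normal_prob m s (F : R -> \bar R) :
  measurable_fun [set: R] F -> (forall x, 0 <= F x)%E ->
  (\int[normal_prob m s]_x F x = \int[leb]_x (F x * (normal_pdf m s x)%:E))%E.
Proof.
move=> mF F0.
pose f_ := nnsfun_approx (@measurableT _ (measurableTypeR R)) mF.
have mpdf : measurable_fun [set: R] (fun x => (normal_pdf m s x)%:E).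
  by apply/measurable_EFinP; exact: measurable_normal_pdf.
transitivity (limn (fun n => \int[normal_prob m s]_x (f_ n x)%:E))%E.
  rewrite -monotone_convergence//.
  - apply: eq_integral => y _; apply/esym/cvg_lim => //.
    exact: cvg_nnsfun_approx.
  - by move=> n; exact/measurable_EFinP/measurable_funP.
  - by move=> n y _; rewrite lee_fin.
  - by move=> y _ i j ij; rewrite lee_fin; exact/lefP/nd_nnsfun_approx.
transitivity (limn (fun n => \int[leb]_x ((f_ n x)%:E * (normal_pdf m s x)%:E)))%E; last first.
  rewrite -monotone_convergence//.
  - apply: eq_integral => y _; apply/cvg_lim => //.
    apply: cvgeZr => //.
    exact: cvg_nnsfun_approx.
  - move=> n; apply: emeasurable_funM => //.
    exact/measurable_EFinP/measurable_funP.
  - by move=> n y _; rewrite -EFinM lee_fin mulr_ge0// normal_pdf_ge0.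
  - move=> y _ i j ij; rewrite -!EFinM lee_fin ler_wpM2r ?normal_pdf_ge0//.
    exact/lefP/nd_nnsfun_approx.
congr (limn _); apply/funext => n.
transitivity (\sum_(k \in range (f_ n))
    (k%:E * \int[leb]_x ((\1_(f_ n @^-1` [set k]) x)%:E * (normal_pdf m s x)%:E)))%E.
  under eq_integral do rewrite fimfunE -fsumEFin//.
  rewrite ge0_integral_fsum//; last 2 first.
  - by move=> y; exact/measurable_EFinP/measurable_funM.
  - by move=> y x _; rewrite nnfun_muleindic_ge0.
  apply: eq_fsbigr => r _; rewrite integralZl_indic_nnsfun// integral_indic//=.
  rewrite setIT /normal_prob; congr (_ * _)%E.
  rewrite integral_mkcond; apply: eq_integral => x _.
  rewrite patchE indicE; case: ifPn => _; first by rewrite mul1e.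
  by rewrite mul0e.
under [RHS]eq_integral.
  move=> x _; rewrite fimfunE -fsumEFin// ge0_mule_fsuml; last first.
    by move=> k; rewrite nnfun_muleindic_ge0.
  over.
rewrite ge0_integral_fsum//; last 2 first.
- by move=> y; apply: emeasurable_funM => //; exact/measurable_EFinP/measurable_funM.
- by move=> y x _; rewrite mule_ge0 ?nnfun_muleindic_ge0// lee_fin normal_pdf_ge0.
apply: eq_fsbigr => r; rewrite inE => -[x _ <-].
under [RHS]eq_integral do rewrite EFinM -muleA.
rewrite ge0_integralZl//.
- apply: emeasurable_funM => //; exact/measurable_EFinP.
- by move=> y _; rewrite -EFinM lee_fin mulr_ge0// normal_pdf_ge0.
- by rewrite lee_fin.
Qed.

(** The translated measure gives half-open intervals their length, so uniqueness of Lebesgue measure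
    applies. *)
Lemma lebesgue_measureD m (A : set R) : measurable A ->
  pushforward leb (fun x : measurableTypeR R => (x + m : measurableTypeR R)) A = leb A.
Proof.
move=> mA; apply/esym.
have mf : measurable_fun [set: measurableTypeR R]
    (fun x : measurableTypeR R => (x + m : measurableTypeR R)).
  exact: measurable_funD.
pose mphi_mixin := isMeasurableFun.Build _ _ _ _ _ mf.
pose phi : {mfun measurableTypeR R >-> measurableTypeR R} :=
  HB.pack (fun x : measurableTypeR R => (x + m : measurableTypeR R)) mphi_mixin.
apply: (@lebesgue_measure_unique R (pushforward leb phi)) => //= _ [[a b]] _ <-.
rewrite /pushforward/=.
have -> : (fun x : measurableTypeR R => (x + m : measurableTypeR R)) @^-1` `]a, b] =
    `]a - m, b - m]%classic.
  by apply/seteqP; split => x /=; rewrite !in_itv/= ltrBlDr lerBrDr.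
rewrite !lebesgue_measure_itv/= !lte_fin ltrD2r; case: ifPn => // _.
by rewrite -!EFinB; congr EFin; ring.
Qed.

Lemma ge0_integral_shift m (F : R -> \bar R) :
  measurable_fun [set: R] F -> (forall x, 0 <= F x)%E ->
  (\int[leb]_x F (x + m)%R = \int[leb]_x F x)%E.
Proof.
move=> mF F0.
have mf : measurable_fun [set: measurableTypeR R]
    (fun x : measurableTypeR R => (x + m : measurableTypeR R)).
  exact: measurable_funD.
transitivity (\int[pushforward leb
    (fun x : measurableTypeR R => (x + m)%R : measurableTypeR R)]_x F x)%E.
  by rewrite (ge0_integral_pushforward mf).
by apply: eq_measure_integral => //= A mA _; exact: lebesgue_measureD.
Qed.

Lemma ge0_integral_opp (F : R -> \bar R) :
  measurable_fun [set: R] F -> (forall x, 0 <= F x)%E ->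
  (\int[leb]_x F (- x)%R = \int[leb]_x F x)%E.
Proof.
move=> mF F0.
transitivity (\int[pushforward leb (-%R : _ -> measurableTypeR R)]_x F x)%E.
  by rewrite ge0_integral_pushforward.
by apply: eq_measure_integral => //= A mA _; exact: lebesgue_measureN.
Qed.

(** The likelihood ratio at [z] between the normal law with mean [m] and the centred one, both with
    deviation [s]. *)
Definition gshift s z m : R := expR ((z * m - m ^+ 2 / 2) / s ^+ 2).

Lemma gshift_gt0 s z m : 0 < gshift s z m.
Proof. exact: expR_gt0. Qed.

Lemma measurable_gshift s m : measurable_fun [set: R] (gshift s ^~ m).
Proof.
apply: measurableT_comp => //; apply: measurable_funM => //.
by apply: measurable_funB => //; exact: measurable_funM.
Qed.

Lemma normal_pdf_shift s z m : s != 0 ->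
  normal_pdf 0 s (z - m) = normal_pdf 0 s z * gshift s z m.
Proof.
move=> s0; rewrite !normal_pdfE// /normal_fun -mulrA /gshift -expRD.
by congr (_ * expR _); rewrite -mulr_natl; field.
Qed.

Lemma normal_pdfN s z : s != 0 -> normal_pdf 0 s (- z) = normal_pdf 0 s z.
Proof. by move=> s0; rewrite !normal_pdfE// /normal_fun !subr0 sqrrN. Qed.

Lemma ge0_integral_normal_shift s m (F : R -> \bar R) : s != 0 ->
  measurable_fun [set: R] F -> (forall x, 0 <= F x)%E ->
  (\int[normal_prob 0 s]_z F (z + m)%R =
   \int[normal_prob 0 s]_z (F z * (gshift s z m)%:E))%E.
Proof.
move=> s0 mF F0.
have mg := measurable_gshift s m.
have mp := @measurable_normal_pdf R 0 s.
rewrite !ge0_integral_normal_prob//.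
- rewrite -[RHS](ge0_integral_shift m).
  + apply: eq_integral => x _.
    rewrite -muleA -EFinM; congr (_ * _%:E)%E.
    by rewrite mulrC -normal_pdf_shift// addrK.
  + by do 2?apply: emeasurable_funM => //; exact/measurable_EFinP.
  + by move=> x; rewrite !mule_ge0 ?lee_fin ?normal_pdf_ge0// ltW// gshift_gt0.
- by apply: emeasurable_funM => //; exact/measurable_EFinP.
- by move=> x; rewrite mule_ge0 ?lee_fin// ltW// gshift_gt0.
- apply: (measurableT_comp mF); exact: measurable_funD.
Qed.

Lemma integral_gshift s m : s != 0 ->
  (\int[normal_prob 0 s]_z (gshift s z m)%:E = 1)%E.
Proof.
move=> s0; have := @ge0_integral_normal_shift s m (cst 1%E) s0.
under [in X in _ -> _ -> _ = X]eq_integral do rewrite /= mul1e.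
move=> H; rewrite -H//.
by rewrite integral_cst_probability.
Qed.

Lemma integrable_gshift s m : s != 0 ->
  (normal_prob 0 s).-integrable [set: R] (fun z => (gshift s z m)%:E).
Proof.
move=> s0; apply/integrableP; split.
  by apply/measurable_EFinP; exact: measurable_gshift.
under eq_integral do rewrite gee0_abs ?lee_fin ?(ltW (gshift_gt0 _ _ _))//.
by rewrite integral_gshift// ltry.
Qed.

Lemma integrable_normal_id s : s != 0 ->
  (normal_prob 0 s).-integrable [set: R] (fun z => z%:E).
Proof.
move=> s0.
(* [|z|] is dominated by [exp z + exp (- z)]; shifts by [s^2] and [- s^2] produce these exponentials
   up to the factor [1 / c], and are integrable. *)
pose c := expR (s ^+ 2 / 2).
pose h (z : R) := (c%:E * (gshift s z (s ^+ 2))%:E + c%:E * (gshift s z (- s ^+ 2))%:E)%E.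
have hE z : h z = (expR z + expR (- z))%:E.
  rewrite /h -!EFinM -EFinD /c /gshift -!expRD; congr (expR _ + expR _)%:E; field.
    exact: s0.
  exact: s0.
have := @le_integrable _ _ _ (normal_prob 0 s) setT measurableT (fun z => z%:E) h.
apply => //; first exact/measurable_EFinP.
- move=> z _; rewrite hE lee_fin.
  have e1 := @expR_ge1Dx R z; have e2 := @expR_ge1Dx R (- z).
  rewrite [leRHS]ger0_norm; last by rewrite addr_ge0 ?expR_ge0.
  have := expR_gt0 z; have := expR_gt0 (- z); rewrite ler_norml; lra.
- by apply: integrableD => //; apply: integrableZl => //; exact: integrable_gshift.
Qed.

Lemma integral_normal_opp s (F : R -> \bar R) : s != 0 ->
  measurable_fun [set: R] F -> (forall x, 0 <= F x)%E ->
  (\int[normal_prob 0 s]_z F (- z)%R = \int[normal_prob 0 s]_z F z)%E.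
Proof.
move=> s0 mF F0.
have mp := @measurable_normal_pdf R 0 s.
rewrite !ge0_integral_normal_prob//.
- rewrite -[RHS]ge0_integral_opp.
  + by apply: eq_integral => x _; rewrite normal_pdfN.
  + by apply: emeasurable_funM => //; exact/measurable_EFinP.
  + by move=> x; rewrite mule_ge0 ?lee_fin ?normal_pdf_ge0.
- exact: (measurableT_comp mF).
Qed.

Lemma integral_normal_id s : s != 0 -> (\int[normal_prob 0 s]_z z%:E = 0)%E.
Proof.
move=> s0; have intid := integrable_normal_id s s0.
rewrite integralE.
(* The symmetry [z -> - z] exchanges the positive and negative parts, which are finite by
   integrability. *)
have -> : (\int[normal_prob 0 s]_z (fun z => z%:E)^\- z =
   \int[normal_prob 0 s]_z (fun z => z%:E)^\+ z)%E.
  rewrite -(integral_normal_opp s (fun z : R => z%:E)^\+%E)//.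
    by apply: eq_integral => z _; rewrite funenegE funeposE EFinN.
  by apply: measurable_funepos; exact/measurable_EFinP.
apply: subee.
have := integrable_funepos measurableT intid.
exact: integrable_fin_num.
Qed.

(** The chain rule for one round, [A] and [B] being the likelihoods of the past answers under two
    data sets. Factoring [gshift s z m] out of the integrand and recentring at [m] leaves an affine
    function of [z] plus a multiple of another shift, all with known integrals. *)
Lemma integral_kl_gshift s m m' A B : s != 0 -> 0 < A -> 0 < B ->
  (\int[normal_prob 0 s]_z (kl (A * gshift s z m) (B * gshift s z m'))%:E =
   (kl A B + A * ((m - m') ^+ 2 / (2 * s ^+ 2)))%:E)%E.
Proof.
move=> s0 A0 B0.
(* The log ratio of the two shifts, expanded around [z = m], is [(z - m) (m - m') / s^2 + (m - m')^2
   / (2 s^2)]; this gives [c1] and [c0]. *)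
pose c0 := A * (ln A - ln B + (m - m') ^+ 2 / (2 * s ^+ 2)) - A.
pose c1 := A * (m - m') / s ^+ 2.
pose G (z : R) := c0 + c1 * (z - m) + B * gshift s (z - m) (m' - m).
have GE z : kl (A * gshift s z m) (B * gshift s z m') = G z * gshift s z m.
  have lnE y : ln (gshift s z y) = (z * y - y ^+ 2 / 2) / s ^+ 2 by rewrite expRK.
  have gE : gshift s (z - m) (m' - m) * gshift s z m = gshift s z m'.
    by rewrite /gshift -expRD; congr expR; field.
  rewrite /kl !lnM ?posrE ?gshift_gt0// !lnE /G [RHS]mulrDl -[X in _ = _ + X]mulrA gE.
  move: (gshift s z m) (gshift s z m') => g g'; rewrite /c0 /c1; field.
  exact: s0.
under eq_integral do rewrite GE EFinM.
rewrite -(@ge0_integral_normal_shift s m (fun z => (G z)%:E))//; last 2 first.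
- apply/measurable_EFinP; apply: measurable_funD.
    by apply: measurable_funD => //; apply: measurable_funM => //; exact: measurable_funB.
  apply: measurable_funM => //.
  apply: (measurableT_comp (measurable_gshift s (m' - m))).
  exact: measurable_funB.
- move=> z; rewrite lee_fin -(pmulr_lge0 _ (gshift_gt0 s z m)) -GE.
  by rewrite kl_ge0// mulr_gt0// gshift_gt0.
under eq_integral.
  move=> z _; rewrite /G addrK 2!EFinD (EFinM c1) (EFinM B); over.
rewrite integralD//=; last 2 first.
- apply: integrableD => //; first exact: finite_measure_integrable_cst.
  by apply: integrableZl => //; exact: integrable_normal_id.
- by apply: integrableZl => //; exact: integrable_gshift.
rewrite integralD//=; last 2 first.
- exact: finite_measure_integrable_cst.
- by apply: integrableZl => //; exact: integrable_normal_id.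
rewrite integral_cst_probability.
rewrite integralZl//; last exact: integrable_normal_id.
rewrite integralZl//; last exact: integrable_gshift.
rewrite integral_normal_id// integral_gshift// mule0 mule1 adde0 -EFinD.
by congr EFin; rewrite /c0 /kl; ring.
Qed.

Lemma integral_normal_expR (c : R) :
  (\int[normal_prob 0 1]_g (expR (c * g))%:E = (expR (c ^+ 2 / 2))%:E)%E.
Proof.
have n1 : (1 : R) != 0 by [].
transitivity (\int[normal_prob 0 1]_g ((expR (c ^+ 2 / 2))%:E * (gshift 1 g c)%:E))%E.
  apply: eq_integral => g _; rewrite -EFinM /gshift -expRD; congr (expR _)%:E.
  by field.
rewrite ge0_integralZl//.
- by rewrite integral_gshift// mule1.
- by apply/measurable_EFinP; exact: measurable_gshift.
- by move=> z _; rewrite lee_fin ltW// gshift_gt0.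
Qed.

(** The weight turns the standard normal density into [(1 - l)^(-1/2)] times the density of variance
    [1 / (1 - l)]. *)
Lemma integral_normal_expR_sqr (l : R) : 0 < l < 1 ->
  (\int[normal_prob 0 1]_g (expR (l * g ^+ 2 / 2))%:E = ((Num.sqrt (1 - l))^-1)%:E)%E.
Proof.
move=> /andP[l0 l1].
have l1' : 0 < 1 - l by lra.
pose s := (Num.sqrt (1 - l))^-1.
have s0 : 0 < s by rewrite invr_gt0 sqrtr_gt0.
have s2 : s ^+ 2 = (1 - l)^-1 by rewrite exprVn sqr_sqrtr// ltW.
rewrite ge0_integral_normal_prob; last 2 first.
- by apply/measurable_EFinP; apply: measurableT_comp => //; apply: measurable_funM => //;
  apply: measurable_funM => //; exact: measurable_funX.
- by move=> g; rewrite lee_fin expR_ge0.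
transitivity (\int[leb]_x (s%:E * (normal_pdf 0 s x)%:E))%E.
  apply: eq_integral => x _; rewrite -!EFinM; congr EFin.
  rewrite !normal_pdfE ?gt_eqF//.
  rewrite /normal_peak /normal_fun s2 expr1n mul1r.
  rewrite -(mulrnAr (1 - l)^-1 pi).
  rewrite sqrtrM ?invr_ge0 ?(ltW l1')// invfM sqrtrV ?(ltW l1')// invrK.
  rewrite [RHS]mulrA [in RHS]mulrA.
  have -> : s * Num.sqrt (1 - l) = 1 by rewrite mulVf// gt_eqF// sqrtr_gt0.
  rewrite mul1r mulrCA -expRD; congr (_ * expR _).
  rewrite subr0 !mulr2n; field.
  by rewrite gt_eqF.
rewrite ge0_integralZl//.
- by rewrite integral_normal_pdf mule1.
- by apply/measurable_EFinP; exact: measurable_normal_pdf.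
- by move=> x _; rewrite lee_fin normal_pdf_ge0.
- by rewrite lee_fin ltW.
Qed.

End normal_integrals.

(** * Entropy of bounded positive functions *)

Section bounded_measurable.
Context {R : realType} d (T : measurableType d).
Implicit Types (f g h : T -> R).

Definition bounded_mfun f := measurable_fun [set: T] f /\ exists M, forall x, `|f x| <= M.

(** The positive lower bound keeps [ln h] bounded as well, so every integral in the entropy
    inequalities is finite and linearity and Fubini apply. *)
Definition bounded_pos_mfun h := measurable_fun [set: T] h /\
  exists c C, 0 < c /\ forall x, c <= h x <= C.

Lemma bounded_mfun_cst (c : R) : bounded_mfun (fun=> c).
Proof. by split => //; exists `|c|. Qed.

Lemma bounded_mfunD f g : bounded_mfun f -> bounded_mfun g ->
  bounded_mfun (fun x => f x + g x).
Proof.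
move=> [mf [M fM]] [mg [N gN]]; split; first exact: measurable_funD.
by exists (M + N) => x; rewrite (le_trans (ler_normD _ _))// lerD.
Qed.

Lemma bounded_mfunB f g : bounded_mfun f -> bounded_mfun g ->
  bounded_mfun (fun x => f x - g x).
Proof.
move=> [mf [M fM]] [mg [N gN]]; split; first exact: measurable_funB.
by exists (M + N) => x; rewrite (le_trans (ler_normB _ _))// lerD.
Qed.

Lemma bounded_mfunM f g : bounded_mfun f -> bounded_mfun g ->
  bounded_mfun (fun x => f x * g x).
Proof.
move=> [mf [M fM]] [mg [N gN]]; split; first exact: measurable_funM.
by exists (M * N) => x; rewrite normrM ler_pM.
Qed.

Lemma bounded_mfun_expR f : bounded_mfun f -> bounded_mfun (fun x => expR (f x)).
Proof.
move=> [mf [M fM]]; split; first exact: measurableT_comp.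
exists (expR M) => x; rewrite ger0_norm ?expR_ge0// ler_expR.
by rewrite (le_trans _ (fM x))// ler_norm.
Qed.

Lemma bounded_pos_mfun_gt0 h x : bounded_pos_mfun h -> 0 < h x.
Proof. by move=> [_ [c [C [c0 hC]]]]; have /andP[ch _] := hC x; exact: lt_le_trans ch. Qed.

Lemma bounded_pos_mfunW h : bounded_pos_mfun h -> bounded_mfun h.
Proof.
move=> bh; have h0 x := bounded_pos_mfun_gt0 h x bh.
case: bh => mh [c [C [c0 hC]]]; split => //; exists C => x.
by rewrite gtr0_norm//; have /andP[] := hC x.
Qed.

Lemma bounded_pos_mfun_ln h : bounded_pos_mfun h -> bounded_mfun (fun x => ln (h x)).
Proof.
move=> bh; have h0 x := bounded_pos_mfun_gt0 h x bh.
case: bh => mh [c [C [c0 hC]]]; split; first exact: measurableT_comp.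
exists (`|ln c| + `|ln C|) => x; have /andP[ch hCx] := hC x.
have : ln c <= ln (h x) by rewrite ler_ln// posrE.
have : ln (h x) <= ln C by rewrite ler_ln// posrE// (lt_le_trans (h0 x)).
have := ler_norm (ln C); have := ler_norm (- ln c); rewrite normrN.
have := normr_ge0 (ln c); have := normr_ge0 (ln C).
by rewrite ler_norml; lra.
Qed.

Variable mu : probability T R.

Lemma bounded_mfun_integrable f : bounded_mfun f -> mu.-integrable setT (EFin \o f).
Proof.
move=> [mf [M fM]]; apply: measurable_bounded_integrable => //.
  by rewrite [X in (X < _)%E]probability_setT ltry.
exists M; split; first exact: num_real.
by move=> x xM t _; exact: (le_trans (fM t) (ltW xM)).
Qed.

Lemma EFin_Rintegral f : bounded_mfun f ->
  (\int[mu]_x (f x)%:E)%E = (\int[mu]_x f x)%:E.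
Proof.
move=> bf; rewrite /Rintegral fineK//.
exact: (integrable_fin_num _ (bounded_mfun_integrable f bf)).
Qed.

Lemma bRintegralD f g : bounded_mfun f -> bounded_mfun g ->
  \int[mu]_x (f x + g x) = \int[mu]_x f x + \int[mu]_x g x.
Proof. by move=> bf bg; rewrite RintegralD//; exact: bounded_mfun_integrable. Qed.

Lemma bRintegralB f g : bounded_mfun f -> bounded_mfun g ->
  \int[mu]_x (f x - g x) = \int[mu]_x f x - \int[mu]_x g x.
Proof. by move=> bf bg; rewrite RintegralB//; exact: bounded_mfun_integrable. Qed.

Lemma bRintegralZl c f : bounded_mfun f ->
  \int[mu]_x (c * f x) = c * \int[mu]_x f x.
Proof. by move=> bf; rewrite RintegralZl//; exact: bounded_mfun_integrable. Qed.

Lemma bRintegralZr c f : bounded_mfun f ->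
  \int[mu]_x (f x * c) = \int[mu]_x f x * c.
Proof. by move=> bf; rewrite RintegralZr//; exact: bounded_mfun_integrable. Qed.

Lemma Rintegral_cst_probability (c : R) : \int[mu]_x c = c.
Proof. by rewrite /Rintegral integral_cst_probability. Qed.

Lemma le_bRintegral f g : bounded_mfun f -> bounded_mfun g ->
  (forall x, f x <= g x) -> \int[mu]_x f x <= \int[mu]_x g x.
Proof.
by move=> bf bg fg; apply: le_Rintegral => //; exact: bounded_mfun_integrable.
Qed.

Lemma bRintegral_gt0 h : bounded_pos_mfun h -> 0 < \int[mu]_x h x.
Proof.
move=> bh; have bh' := bounded_pos_mfunW h bh; case: bh => mh [c [C [c0 hC]]].
apply: (lt_le_trans c0); rewrite -[leLHS](Rintegral_cst_probability c).
apply: le_bRintegral => //; first exact: bounded_mfun_cst.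
by move=> x; have /andP[] := hC x.
Qed.

End bounded_measurable.
Arguments bounded_mfun {R d T}.
Arguments bounded_pos_mfun {R d T}.

Section bounded_comp.
Context {R : realType} d d' (T : measurableType d) (T' : measurableType d').

Lemma bounded_mfun_comp (f : T' -> R) (g : T -> T') : measurable_fun [set: T] g ->
  bounded_mfun f -> bounded_mfun (fun x => f (g x)).
Proof.
by move=> mg [mf [M fM]]; split; [exact: (measurableT_comp mf)|exists M].
Qed.

Lemma bounded_pos_mfun_comp (f : T' -> R) (g : T -> T') : measurable_fun [set: T] g ->
  bounded_pos_mfun f -> bounded_pos_mfun (fun x => f (g x)).
Proof.
move=> mg [mf [c [C [c0 fC]]]]; split; first exact: (measurableT_comp mf).
by exists c, C; split.
Qed.

End bounded_comp.

Section bounded_fubini.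
Context {R : realType} d1 d2 (T1 : measurableType d1) (T2 : measurableType d2).
Variables (mu : probability T1 R) (nu : probability T2 R).
Implicit Types (f h : T1 * T2 -> R).

Let bint f : bounded_mfun f -> (mu \x nu)%E.-integrable setT (EFin \o f).
Proof. exact: bounded_mfun_integrable. Qed.

Lemma bounded_mfun_x f x : bounded_mfun f -> bounded_mfun (fun y => f (x, y)).
Proof. exact/bounded_mfun_comp/measurable_pair1. Qed.

Lemma bounded_mfun_y f y : bounded_mfun f -> bounded_mfun (fun x => f (x, y)).
Proof. exact/bounded_mfun_comp/measurable_pair2. Qed.

Lemma bounded_pos_mfun_x f x : bounded_pos_mfun f -> bounded_pos_mfun (fun y => f (x, y)).
Proof. exact/bounded_pos_mfun_comp/measurable_pair1. Qed.

Lemma bounded_pos_mfun_y f y : bounded_pos_mfun f -> bounded_pos_mfun (fun x => f (x, y)).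
Proof. exact/bounded_pos_mfun_comp/measurable_pair2. Qed.

Lemma bRintegral_bound d (T : measurableType d) (P : probability T R) (f : T -> R) a b :
  bounded_mfun f -> (forall x, a <= f x <= b) -> a <= \int[P]_x f x <= b.
Proof.
move=> bf fab; apply/andP; split.
- rewrite -[leLHS](Rintegral_cst_probability _ _ P); apply: le_bRintegral => //.
    exact: bounded_mfun_cst.
  by move=> x; have /andP[] := fab x.
- rewrite -[leRHS](Rintegral_cst_probability _ _ P); apply: le_bRintegral => //.
    exact: bounded_mfun_cst.
  by move=> x; have /andP[] := fab x.
Qed.

Lemma bounded_mfun_Rintegral_y f : bounded_mfun f ->
  bounded_mfun (fun x => \int[nu]_y f (x, y)).
Proof.
move=> bf; split.
  apply: (measurableT_comp (@fine_measurable R setT measurableT)) => //.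
  exact: (measurable_fubini_F (bint f bf)).
have [_ [M fM]] := bf; exists M => x; rewrite ler_norml.
apply: bRintegral_bound; first exact: bounded_mfun_x.
by move=> y; rewrite -ler_norml.
Qed.

Lemma bounded_mfun_Rintegral_x f : bounded_mfun f ->
  bounded_mfun (fun y => \int[mu]_x f (x, y)).
Proof.
move=> bf; split.
  apply: (measurableT_comp (@fine_measurable R setT measurableT)) => //.
  exact: (measurable_fubini_G (bint f bf)).
have [_ [M fM]] := bf; exists M => x; rewrite ler_norml.
apply: bRintegral_bound; first exact: bounded_mfun_y.
by move=> y; rewrite -ler_norml.
Qed.

Lemma bounded_pos_mfun_Rintegral_y f : bounded_pos_mfun f ->
  bounded_pos_mfun (fun x => \int[nu]_y f (x, y)).
Proof.
move=> bf; have bf' := bounded_pos_mfunW _ _ _ bf.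
split; first by have [] := bounded_mfun_Rintegral_y f bf'.
have [_ [c [C [c0 fC]]]] := bf; exists c, C; split => // x.
by apply: bRintegral_bound => //; exact: bounded_mfun_x.
Qed.

Lemma bounded_pos_mfun_Rintegral_x f : bounded_pos_mfun f ->
  bounded_pos_mfun (fun y => \int[mu]_x f (x, y)).
Proof.
move=> bf; have bf' := bounded_pos_mfunW _ _ _ bf.
split; first by have [] := bounded_mfun_Rintegral_x f bf'.
have [_ [c [C [c0 fC]]]] := bf; exists c, C; split => // x.
by apply: bRintegral_bound => //; exact: bounded_mfun_y.
Qed.

Lemma Rintegral12 f : bounded_mfun f ->
  \int[(mu \x nu)%E]_z f z = \int[mu]_x \int[nu]_y f (x, y).
Proof.
move=> bf; rewrite /Rintegral -(integral12_prod_meas1 (bint f bf)).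
congr fine; apply: eq_integral => x _; rewrite /fubini_F EFin_Rintegral//.
exact: bounded_mfun_x.
Qed.

Lemma Rintegral21 f : bounded_mfun f ->
  \int[(mu \x nu)%E]_z f z = \int[nu]_y \int[mu]_x f (x, y).
Proof.
move=> bf; rewrite /Rintegral -(integral21_prod_meas1 (bint f bf)).
congr fine; apply: eq_integral => x _; rewrite /fubini_G EFin_Rintegral//.
exact: bounded_mfun_y.
Qed.

End bounded_fubini.

(** * Entropy inequalities deduced from nonnegativity of the divergence *)

Section entropy.
Context {R : realType}.

(** Written for functions of arbitrary mass, because at fixed answers the likelihood is not a
    probability density in the data. *)
Definition entropy d (T : measurableType d) (mu : probability T R) (h : T -> R) : R :=
  \int[mu]_x (h x * ln (h x)) - (\int[mu]_x h x) * ln (\int[mu]_x h x).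

Section one_measure.
Context d (T : measurableType d) (mu : probability T R).
Implicit Types (f h b : T -> R).

(** Common source of the entropy inequalities below, through the choice of the reference [b]: the
    mean of [h] for nonnegativity, an exponential tilt for duality, a product of marginals for
    subadditivity. A constant [h] gives Jensen's inequality for [ln]. *)
Lemma Rintegral_kl_ge0 h b : bounded_pos_mfun h -> bounded_mfun (fun x => ln (b x)) ->
  bounded_mfun b -> (forall x, 0 < b x) ->
  0 <= \int[mu]_x (h x * ln (h x)) - \int[mu]_x (h x * ln (b x))
       - \int[mu]_x h x + \int[mu]_x b x.
Proof.
move=> bh blb bb b0.
have bh' := bounded_pos_mfunW _ _ _ bh.
have blh := bounded_pos_mfun_ln _ _ _ bh.
have -> : \int[mu]_x (h x * ln (h x)) - \int[mu]_x (h x * ln (b x))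
       - \int[mu]_x h x + \int[mu]_x b x = \int[mu]_x kl (h x) (b x).
  rewrite -bRintegralB; [|exact: bounded_mfunM|exact: bounded_mfunM].
  rewrite -bRintegralB//; last by apply: bounded_mfunB; exact: bounded_mfunM.
  rewrite -bRintegralD//; last by do 2 apply: bounded_mfunB => //; exact: bounded_mfunM.
  by apply: eq_Rintegral => x _; rewrite /kl; ring.
by apply: Rintegral_ge0 => x _; rewrite kl_ge0// (bounded_pos_mfun_gt0 _ _ _ _ bh).
Qed.

Lemma entropy_ge0 h : bounded_pos_mfun h -> 0 <= entropy _ _ mu h.
Proof.
move=> bh; have m0 := bRintegral_gt0 _ _ mu _ bh.
have bh' := bounded_pos_mfunW _ _ _ bh.
have := Rintegral_kl_ge0 _ (fun=> \int[mu]_x h x) bh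
  (bounded_mfun_cst _ _ _) (bounded_mfun_cst _ _ _) (fun=> m0).
rewrite bRintegralZr// Rintegral_cst_probability subrK; exact.
Qed.

Lemma entropy_duality h f C : bounded_pos_mfun h -> bounded_mfun f -> 0 < C ->
  \int[mu]_x expR (f x) <= C ->
  \int[mu]_x (h x * f x) <= entropy _ _ mu h + (\int[mu]_x h x) * ln C.
Proof.
move=> bh bf C0 efC.
have m0 := bRintegral_gt0 _ _ mu _ bh.
have bh' := bounded_pos_mfunW _ _ _ bh.
set m := \int[mu]_x h x in m0 *.
have lnbE x : ln (m / C * expR (f x)) = f x + (ln m - ln C).
  by rewrite lnM ?posrE ?expR_gt0 ?divr_gt0// ln_div// expRK addrC.
(* The factor [m / C] brings the mass of the tilt down to at most [m], so the two linear terms of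
   the divergence sum to at most 0. *)
have := Rintegral_kl_ge0 h (fun x => m / C * expR (f x)) bh.
rewrite /=.
under eq_fun do rewrite lnbE.
move=> /(_ (bounded_mfunD _ _ _ _ bf (bounded_mfun_cst _ _ _))).
have be := bounded_mfun_expR _ _ _ bf.
move=> /(_ (bounded_mfunM _ _ _ _ (bounded_mfun_cst _ _ _) be)).
have p x : 0 < m / C * expR (f x) by rewrite mulr_gt0 ?expR_gt0// divr_gt0.
move=> /(_ p).
rewrite (@bRintegralZl _ _ _ mu (m / C))//.
under [X in _ - X - _]eq_Rintegral do rewrite lnbE mulrDr.
rewrite bRintegralD; [|exact: bounded_mfunM|apply: bounded_mfunM => //; exact: bounded_mfun_cst].
rewrite bRintegralZr// -/m /entropy -/m => H.
have : m / C * \int[mu]_x expR (f x) <= m.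
  by rewrite -mulrA ger_pMr// mulrC ler_pdivrMr// mul1r.
lra.
Qed.

(** In the double integral the linear terms cancel, leaving the mean of [h ln h] minus [m] times the
    mean of [ln h]; Jensen bounds the latter mean by [ln m]. *)
Lemma entropy_le_kl h : bounded_pos_mfun h ->
  entropy _ _ mu h <= \int[mu]_t \int[mu]_u kl (h t) (h u).
Proof.
move=> bh.
have m0 := bRintegral_gt0 _ _ mu _ bh.
have bh' := bounded_pos_mfunW _ _ _ bh.
have blh := bounded_pos_mfun_ln _ _ _ bh.
set m := \int[mu]_x h x in m0 *.
set L := \int[mu]_x ln (h x).
have Lm : L <= ln m.
  have bm : bounded_pos_mfun (fun _ : T => m).
    by split => //; exists m, m; split => // x; rewrite lexx.
  have := Rintegral_kl_ge0 (fun=> m) h bm blh bh' (fun x => bounded_pos_mfun_gt0 _ _ _ x bh).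
  rewrite !Rintegral_cst_probability bRintegralZl// -/L -/m subrK -mulrBr.
  by rewrite pmulr_rge0// subr_ge0.
have inner t : \int[mu]_u kl (h t) (h u) = h t * ln (h t) - h t * L - h t + m.
  rewrite /kl bRintegralD//; last first.
    apply: bounded_mfunB; last exact: bounded_mfun_cst.
    apply: bounded_mfunM; first exact: bounded_mfun_cst.
    by apply: bounded_mfunB => //; exact: bounded_mfun_cst.
  rewrite bRintegralB; [| |exact: bounded_mfun_cst]; last first.
    apply: bounded_mfunM; first exact: bounded_mfun_cst.
    by apply: bounded_mfunB => //; exact: bounded_mfun_cst.
  rewrite bRintegralZl; last by apply: bounded_mfunB => //; exact: bounded_mfun_cst.
  rewrite bRintegralB//; last exact: bounded_mfun_cst.
  by rewrite !Rintegral_cst_probability -/L -/m mulrBr.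
under eq_Rintegral do rewrite inner.
rewrite bRintegralD; [| |exact: bounded_mfun_cst]; last first.
  by do 2 apply: bounded_mfunB => //; apply: bounded_mfunM => //; exact: bounded_mfun_cst.
rewrite bRintegralB//; last first.
  by apply: bounded_mfunB; apply: bounded_mfunM => //; exact: bounded_mfun_cst.
rewrite bRintegralB; [|exact: bounded_mfunM|apply: bounded_mfunM => //; exact: bounded_mfun_cst].
rewrite bRintegralZr// Rintegral_cst_probability -/m /entropy -/m.
have : m * L <= m * ln m by rewrite ler_pM2l.
lra.
Qed.

End one_measure.

Lemma entropy_subadditive d1 d2 (T1 : measurableType d1) (T2 : measurableType d2)
    (mu : probability T1 R) (nu : probability T2 R) (h : T1 * T2 -> R) :
  bounded_pos_mfun h ->
  entropy _ _ (mu \x nu)%E h <=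
    \int[nu]_y entropy _ _ mu (fun x => h (x, y)) +
    \int[mu]_x entropy _ _ nu (fun y => h (x, y)).
Proof.
move=> bh.
have bh' := bounded_pos_mfunW _ _ _ bh.
have blh := bounded_pos_mfun_ln _ _ _ bh.
have m0 := bRintegral_gt0 _ _ (mu \x nu)%E _ bh.
set pi := (mu \x nu)%E in m0 *.
set m := \int[pi]_x h x in m0 *.
pose H x := \int[nu]_y h (x, y).
pose V y := \int[mu]_x h (x, y).
have bH : bounded_pos_mfun H := bounded_pos_mfun_Rintegral_y _ _ _ _ mu nu _ bh.
have bV : bounded_pos_mfun V := bounded_pos_mfun_Rintegral_x _ _ _ _ mu nu _ bh.
have H0 x := bounded_pos_mfun_gt0 _ _ _ x bH.
have V0 y := bounded_pos_mfun_gt0 _ _ _ y bV.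
have bH' := bounded_pos_mfunW _ _ _ bH.
have bV' := bounded_pos_mfunW _ _ _ bV.
have blH := bounded_pos_mfun_ln _ _ _ bH.
have blV := bounded_pos_mfun_ln _ _ _ bV.
have bH1 := bounded_mfun_comp _ _ _ _ _ _ (@measurable_fst _ _ T1 T2) bH'.
have bV2 := bounded_mfun_comp _ _ _ _ _ _ (@measurable_snd _ _ T1 T2) bV'.
have blH1 := bounded_mfun_comp _ _ _ _ _ _ (@measurable_fst _ _ T1 T2) blH.
have blV2 := bounded_mfun_comp _ _ _ _ _ _ (@measurable_snd _ _ T1 T2) blV.
have mH : \int[mu]_x H x = m by rewrite /m Rintegral12.
have mV : \int[nu]_y V y = m by rewrite /m Rintegral21.
have lnbE z : ln (H z.1 * V z.2 / m) = ln (H z.1) + (ln (V z.2) - ln m).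
  by rewrite ln_div ?posrE ?mulr_gt0// lnM ?posrE// addrA.
(* The product of the marginals over [m] has the same mass as [h], so the linear terms cancel. What
   remains compares [h ln h] with the marginal terms and is a rearrangement of the goal. *)
have := Rintegral_kl_ge0 _ _ pi h (fun z => H z.1 * V z.2 / m) bh.
have blb : bounded_mfun (fun z : T1 * T2 => ln (H z.1 * V z.2 / m)).
  under eq_fun do rewrite lnbE.
  apply: bounded_mfunD => //; apply: bounded_mfunB => //; exact: bounded_mfun_cst.
have bb : bounded_mfun (fun z : T1 * T2 => H z.1 * V z.2 / m).
  by apply: bounded_mfunM; [exact: bounded_mfunM|exact: bounded_mfun_cst].
move=> /(_ blb bb).
have b0 (z : T1 * T2) : 0 < H z.1 * V z.2 / m by rewrite divr_gt0// mulr_gt0.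
move=> /(_ b0); rewrite -/m.
have -> : \int[pi]_x (H x.1 * V x.2 / m) = m.
  rewrite bRintegralZr; last exact: bounded_mfunM.
  rewrite Rintegral12 /=; last exact: bounded_mfunM.
  under eq_Rintegral do rewrite bRintegralZl//.
  by rewrite bRintegralZr// mH mV mulfK// gt_eqF.
under [X in _ - X - _ + _]eq_Rintegral do rewrite lnbE mulrDr mulrBr.
have bhH : bounded_mfun (fun z => h z * ln (H z.1)) by exact: bounded_mfunM.
have bhV : bounded_mfun (fun z => h z * ln (V z.2)) by exact: bounded_mfunM.
have bhm : bounded_mfun (fun z => h z * ln m).
  by apply: bounded_mfunM => //; exact: bounded_mfun_cst.
have bhh : bounded_mfun (fun z => h z * ln (h z)) by exact: bounded_mfunM.
rewrite bRintegralD//; last exact: bounded_mfunB.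
rewrite bRintegralB// bRintegralZr// -/m.
have -> : \int[pi]_x (h x * ln (H x.1)) = \int[mu]_x (H x * ln (H x)).
  rewrite Rintegral12//; apply: eq_Rintegral => x _ /=.
  by rewrite bRintegralZr//; exact: bounded_mfun_x.
have -> : \int[pi]_x (h x * ln (V x.2)) = \int[nu]_x (V x * ln (V x)).
  rewrite Rintegral21//; apply: eq_Rintegral => x _ /=.
  by rewrite bRintegralZr//; exact: bounded_mfun_y.
rewrite subrK.
rewrite /entropy -/m.
rewrite (bRintegralB _ _ nu (fun y => \int[mu]_x (h (x, y) * ln (h (x, y))))
  (fun y => V y * ln (V y))); last 2 first.
- exact: (bounded_mfun_Rintegral_x _ _ _ _ mu nu _ bhh).
- exact: bounded_mfunM.
rewrite (bRintegralB _ _ mu (fun x => \int[nu]_y (h (x, y) * ln (h (x, y))))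
  (fun y => H y * ln (H y))); last 2 first.
- exact: (bounded_mfun_Rintegral_y _ _ _ _ mu nu _ bhh).
- exact: bounded_mfunM.
rewrite -(Rintegral12 _ _ _ _ mu nu _ bhh) -(Rintegral21 _ _ _ _ mu nu _ bhh) -/pi.
lra.
Qed.

End entropy.

(** * Product measures on tuples *)

Section rcons_tuples.
Context {T : Type} {n : nat}.
Implicit Types (y : n.-tuple T) (b : n.+1.-tuple T).

Lemma ord_recrP (i : 'I_n.+1) : i = ord_max \/ exists j : 'I_n, i = widen_ord (leqnSn n) j.
Proof.
have [/eqP i_n|i_n] := boolP (i == ord_max); [by left|right].
have lt_in : (i < n)%N.
  rewrite ltn_neqAle -ltnS ltn_ord andbT; apply: contra i_n => /eqP i_n.
  exact/eqP/val_inj.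
by exists (Ordinal lt_in); exact/val_inj.
Qed.

Lemma tnth_rcons_widen y t (j : 'I_n) :
  tnth (rcons_tuple y t) (widen_ord (leqnSn n) j) = tnth y j.
Proof. by rewrite !(tnth_nth t)/= nth_rcons size_tuple ltn_ord. Qed.

Lemma tnth_rcons_max y t : tnth (rcons_tuple y t) ord_max = t.
Proof. by rewrite (tnth_nth t)/= nth_rcons size_tuple ltnn eqxx. Qed.

Definition tinit b : n.-tuple T := [tuple tnth b (widen_ord (leqnSn n) j) | j < n].
Definition tlast b : T := tnth b ord_max.

Lemma tinit_rcons y t : tinit (rcons_tuple y t) = y.
Proof. by apply: eq_from_tnth => j; rewrite tnth_mktuple tnth_rcons_widen. Qed.

Lemma tlast_rcons y t : tlast (rcons_tuple y t) = t.
Proof. exact: tnth_rcons_max. Qed.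

Lemma rcons_tinit_tlast b : rcons_tuple (tinit b) (tlast b) = b.
Proof.
apply: eq_from_tnth => i; have [->|[j ->]] := ord_recrP i.
  by rewrite tnth_rcons_max.
by rewrite tnth_rcons_widen tnth_mktuple.
Qed.

End rcons_tuples.

Definition neighbor {T : Type} {n : nat} (x y : n.-tuple T) :=
  exists j : 'I_n, forall i, i != j -> tnth x i = tnth y i.

Lemma neighbor_rcons_l {T : Type} {n : nat} (x y : n.-tuple T) t :
  neighbor x y -> neighbor (rcons_tuple x t) (rcons_tuple y t).
Proof.
move=> [j xy]; exists (widen_ord (leqnSn n) j) => i.
have [->|[k ->]] := ord_recrP i; first by rewrite !tnth_rcons_max.
rewrite !tnth_rcons_widen => kj; apply: xy; apply: contra kj => /eqP ->.
exact: eqxx.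
Qed.

Lemma neighbor_rcons_r {T : Type} {n : nat} (x : n.-tuple T) t u :
  neighbor (rcons_tuple x t) (rcons_tuple x u).
Proof.
exists ord_max => i; have [->|[k ->]] := ord_recrP i; first by rewrite eqxx.
by rewrite !tnth_rcons_widen.
Qed.

Section measurable_tuples.
Context d0 d (A : measurableType d0) (T : measurableType d).

Lemma measurable_rcons n (f : A -> n.-tuple T) (g : A -> T) :
  measurable_fun [set: A] f -> measurable_fun [set: A] g ->
  measurable_fun [set: A] (fun a => rcons_tuple (f a) (g a)).
Proof.
move=> mf mg; apply/measurable_fun_tnthP => i /=.
have [->|[j ->]] := ord_recrP i.
  by rewrite (_ : _ \o _ = g)//; apply/funext => a /=; rewrite tnth_rcons_max.
rewrite (_ : _ \o _ = fun a => tnth (f a) j).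
  exact: (measurableT_comp (measurable_tnth j)).
by apply/funext => a /=; rewrite tnth_rcons_widen.
Qed.

Lemma measurable_tinit n (f : A -> n.+1.-tuple T) :
  measurable_fun [set: A] f -> measurable_fun [set: A] (fun a => tinit (f a)).
Proof.
move=> mf; apply/measurable_fun_tnthP => i /=.
rewrite (_ : _ \o _ = fun a => tnth (f a) (widen_ord (leqnSn n) i)).
  exact: (measurableT_comp (measurable_tnth _)).
by apply/funext => a /=; rewrite tnth_mktuple.
Qed.

Lemma measurable_tlast n (f : A -> n.+1.-tuple T) :
  measurable_fun [set: A] f -> measurable_fun [set: A] (fun a => tlast (f a)).
Proof. by move=> mf; exact: (measurableT_comp (measurable_tnth _)). Qed.

End measurable_tuples.

Lemma integral_probability_le {R : realType} d (T : measurableType d)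
    (P : probability T R) (f : T -> \bar R) (c : \bar R) :
  measurable_fun setT f -> (forall x, 0 <= f x)%E -> (forall x, f x <= c)%E ->
  (\int[P]_x f x <= c)%E.
Proof.
move=> mf f0 fc; rewrite -[leRHS](integral_cst_probability _ _ P).
by apply: ge0_le_integral.
Qed.

(** * Powers of a probability and the sum of resampling divergences *)

Section power_measure.
Context {R : realType} {d} {T : measurableType d}.
Variable D : probability T R.

Definition rcons_pair n (p : n.-tuple T * T) : n.+1.-tuple T := rcons_tuple p.1 p.2.

Lemma measurable_rcons_pair n : measurable_fun [set: n.-tuple T * T] (rcons_pair n).
Proof. exact: measurable_rcons. Qed.

HB.instance Definition _ n := isMeasurableFun.Build _ _ _ _
  (rcons_pair n) (measurable_rcons_pair n).

(** Grows at the right end, as [transcript] does. It serves for the data and for the noise, so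
    inductions on samples and on rounds both peel off the last coordinate. *)
Fixpoint power_prob n : probability (n.-tuple T) R :=
  match n with
  | 0 => \d_([tuple] : 0.-tuple T)
  | m.+1 => distribution (power_prob m \x D)%E (rcons_pair m)
  end.

Lemma ge0_integral_power0 (F : 0.-tuple T -> \bar R) :
  measurable_fun setT F ->
  (\int[power_prob 0]_x F x = F [tuple])%E.
Proof. by move=> mF; rewrite /= integral_dirac// diracT mul1e. Qed.

Lemma ge0_integral_powerS_prod n (F : n.+1.-tuple T -> \bar R) :
  measurable_fun setT F -> (forall x, 0 <= F x)%E ->
  (\int[power_prob n.+1]_x F x = \int[power_prob n \x D]_p F (rcons_tuple p.1 p.2))%E.
Proof. by move=> mF F0; rewrite /= ge0_integral_distribution. Qed.

Lemma ge0_integral_powerS n (F : n.+1.-tuple T -> \bar R) :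
  measurable_fun setT F -> (forall x, 0 <= F x)%E ->
  (\int[power_prob n.+1]_x F x = \int[power_prob n]_y \int[D]_t F (rcons_tuple y t))%E.
Proof.
move=> mF F0; rewrite ge0_integral_powerS_prod// fubini_tonelli1//.
exact: (measurableT_comp mF (measurable_rcons_pair n)).
Qed.

Lemma power_probX n (A : 'I_n -> set T) : (forall j, measurable (A j)) ->
  power_prob n (\bigcap_(j in [set: 'I_n]) ((fun x => tnth x j) @^-1` A j)) =
  (\prod_(j < n) D (A j))%E.
Proof.
elim: n A => [|n IH] A mA.
  rewrite big_ord0 (_ : \bigcap_(j in _) _ = setT); last first.
    by apply/seteqP; split => // x _ [].
  exact: probability_setT.
rewrite big_ord_recr/= -(IH (fun j => A (widen_ord (leqnSn n) j)))//.
rewrite /distribution /pushforward -product_measure1E//; last first.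
  apply: fin_bigcap_measurable => // j _.
  by rewrite -[X in measurable X]setTI; exact: measurable_tnth.
congr (_ _); apply/seteqP; split => [[y t] H /=|[y t] [/= Hy Ht] i _ /=].
  split.
    move=> j _ /=; have := H (widen_ord (leqnSn n) j) I.
    by rewrite /= tnth_rcons_widen.
  by have := H ord_max I; rewrite /= tnth_rcons_max.
have [->|[j ->]] := ord_recrP i; first by rewrite tnth_rcons_max.
by rewrite tnth_rcons_widen; exact: Hy.
Qed.

Lemma entropy_powerS n (h : n.+1.-tuple T -> R) : bounded_pos_mfun h ->
  entropy _ _ (power_prob n.+1) h =
  entropy _ _ (power_prob n \x D)%E (fun p => h (rcons_tuple p.1 p.2)).
Proof.
move=> bh.
have intE (f : n.+1.-tuple T -> R) : bounded_mfun f ->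
   \int[power_prob n.+1]_x f x = \int[(power_prob n \x D)%E]_p f (rcons_tuple p.1 p.2).
  move=> bf; rewrite /Rintegral /= integral_distribution//.
    by apply/measurable_EFinP; exact: bf.1.
  apply: (bounded_mfun_integrable _ _ _ (fun p => f (rcons_tuple p.1 p.2))).
  exact: (bounded_mfun_comp _ _ _ _ _ _ (measurable_rcons_pair n) bf).
have bh' := bounded_pos_mfunW _ _ _ bh.
have blh := bounded_pos_mfun_ln _ _ _ bh.
by rewrite /entropy !intE//; exact: bounded_mfunM.
Qed.

(* Sum over the coordinates of the mean divergence caused by resampling that
   coordinate; the recursion peels off the last one. *)
Fixpoint klsum n : (n.-tuple T -> R) -> \bar R :=
  match n with
  | 0 => fun _ => 0%E
  | m.+1 => fun h =>
      (\int[D]_t klsum m (fun y => h (rcons_tuple y t)) +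
       \int[power_prob m]_y \int[D]_t \int[D]_u
         (kl (h (rcons_tuple y t)) (h (rcons_tuple y u)))%:E)%E
  end.

Lemma klsum_ge0 n (h : n.-tuple T -> R) : (forall x, 0 < h x) -> (0 <= klsum n h)%E.
Proof.
elim: n h => [//|n IH] h h0 /=; apply: adde_ge0.
  by apply: integral_ge0 => t _; exact: IH.
by do 3 (apply: integral_ge0 => ? _); rewrite lee_fin kl_ge0.
Qed.

Lemma measurable_kl d0 (A : measurableType d0) (f g : A -> R) :
  measurable_fun setT f -> measurable_fun setT g ->
  measurable_fun setT (fun a => kl (f a) (g a)).
Proof.
move=> mf mg; apply: measurable_funD => //; apply: measurable_funB => //.
by apply: measurable_funM => //; apply: measurable_funB; exact: measurableT_comp.
Qed.

(** The variables are nested as [(((a, y), t), u)] so that integrating out the last component three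
    times yields the second summand of [klsum]. *)
Lemma measurable_klsum_tail n d0 (A : measurableType d0) (h : A * n.+1.-tuple T -> R) :
  measurable_fun setT h ->
  measurable_fun setT (fun p : ((A * n.-tuple T) * T) * T =>
   (kl (h (p.1.1.1, rcons_tuple p.1.1.2 p.1.2)) (h (p.1.1.1, rcons_tuple p.1.1.2 p.2)))%:E).
Proof.
move=> mh; apply/measurable_EFinP; apply: measurable_kl;
  apply: (measurableT_comp mh); apply: measurable_fun_pair => //.
- by do 2 apply: measurableT_comp => //.
- apply: measurable_rcons; first by do 2 apply: measurableT_comp => //.
  by apply: measurableT_comp.
- by do 2 apply: measurableT_comp => //.
- by apply: measurable_rcons => //; do 2 apply: measurableT_comp => //.
Qed.

(** The parameter space [A] is arbitrary because the induction enlarges it: the peeled-off data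
    point moves into [A * T]. *)
Lemma measurable_klsum n d0 (A : measurableType d0) (h : A * n.-tuple T -> R) :
  measurable_fun setT h -> (forall x, 0 < h x) ->
  measurable_fun setT (fun a => klsum n (fun x => h (a, x))).
Proof.
elim: n d0 A h => [//|n IH] d0 A h mh h0 /=; apply: emeasurable_funD.
  apply: (@measurable_fun_fubini_tonelli_F _ _ A T R D
    (fun p => klsum n (fun y => h (p.1, rcons_tuple y p.2)))).
    apply: (IH _ (A * T)%type (fun q => h (q.1.1, rcons_tuple q.2 q.1.2))) => //.
    apply: (measurableT_comp mh); apply: measurable_fun_pair => //=.
      exact: measurableT_comp.
    by apply: measurable_rcons => //; exact: measurableT_comp.
  by move=> p; exact: klsum_ge0.
have m3 := measurable_klsum_tail n _ _ h mh.
have m2 := measurable_fun_fubini_tonelli_F (m2 := D) _ m3.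
have {}m2 := measurable_fun_fubini_tonelli_F (m2 := D) _ (m2 _).
have {}m2 := measurable_fun_fubini_tonelli_F (m2 := power_prob n) _ (m2 _ _).
apply: m2.
- by move=> p; rewrite lee_fin kl_ge0.
- by move=> p; apply: integral_ge0 => u _; rewrite lee_fin kl_ge0.
- by move=> p; do 2 (apply: integral_ge0 => ? _); rewrite lee_fin kl_ge0.
Qed.

(** Subadditivity splits off the last coordinate: its share is bounded by [entropy_le_kl], and the
    slices in the other coordinates by induction. *)
Lemma entropy_le_klsum n (h : n.-tuple T -> R) : bounded_pos_mfun h ->
  ((entropy _ _ (power_prob n) h)%:E <= klsum n h)%E.
Proof.
elim: n h => [|n IH] h bh.
  have bh' := bounded_pos_mfunW _ _ _ bh.
  have [mhl _] := bounded_mfunM _ _ _ _ bh' (bounded_pos_mfun_ln _ _ _ bh).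
  have [mh _] := bh.
  rewrite /entropy /Rintegral (ge0_integral_power0 _ ((measurable_EFinP _ _).2 mhl)).
  by rewrite (ge0_integral_power0 _ ((measurable_EFinP _ _).2 mh)) subrr.
rewrite entropy_powerS//.
have bhr := bounded_pos_mfun_comp _ _ _ _ _ _ (measurable_rcons_pair n) bh.
have h0 x := bounded_pos_mfun_gt0 _ _ _ x bh.
have bhr' := bounded_pos_mfunW _ _ _ bhr.
have blhr := bounded_pos_mfun_ln _ _ _ bhr.
have := entropy_subadditive _ _ _ _ (power_prob n) D _ bhr.
rewrite -lee_fin => /le_trans; apply.
rewrite EFinD /=.
have [mhr _] := bhr.
have bhlh := bounded_mfunM _ _ _ _ bhr' blhr.
have bE1 : bounded_mfun (fun t => entropy _ _ (power_prob n) (fun y => h (rcons_tuple y t))).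
  rewrite /entropy; apply: bounded_mfunB.
    exact: (bounded_mfun_Rintegral_x _ _ _ _ (power_prob n) D _ bhlh).
  apply: bounded_mfunM.
    exact: (bounded_mfun_Rintegral_x _ _ _ _ (power_prob n) D _ bhr').
  apply: bounded_pos_mfun_ln.
  exact: (bounded_pos_mfun_Rintegral_x _ _ _ _ (power_prob n) D _ bhr).
have bE2 : bounded_mfun (fun y => entropy _ _ D (fun t => h (rcons_tuple y t))).
  rewrite /entropy; apply: bounded_mfunB.
    exact: (bounded_mfun_Rintegral_y _ _ _ _ (power_prob n) D _ bhlh).
  apply: bounded_mfunM.
    exact: (bounded_mfun_Rintegral_y _ _ _ _ (power_prob n) D _ bhr').
  apply: bounded_pos_mfun_ln.
  exact: (bounded_pos_mfun_Rintegral_y _ _ _ _ (power_prob n) D _ bhr).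
apply: leeD.
- rewrite -EFin_Rintegral//; apply: ge0_le_integral => //.
  + move=> t _; rewrite lee_fin entropy_ge0//.
    exact: (bounded_pos_mfun_y _ _ _ _ _ _ bhr).
  + by apply/measurable_EFinP; case: bE1.
  + apply: (measurable_klsum n _ _ (fun p => h (rcons_tuple p.2 p.1))) => //.
    by apply: (measurableT_comp bh.1); exact: measurable_rcons.
  + move=> t _; apply: IH.
    exact: (bounded_pos_mfun_y _ _ _ _ _ _ bhr).
- rewrite -EFin_Rintegral//.
  (* Boundedness of [K] converts the extended-real iterated integral of [klsum] into the real one of
     [entropy_le_kl]. *)
  pose K (p : (n.-tuple T * T) * T) : R :=
    kl (h (rcons_tuple p.1.1 p.1.2)) (h (rcons_tuple p.1.1 p.2)).
  have bK : bounded_mfun K.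
    have mg1 : measurable_fun setT (fun p : (n.-tuple T * T) * T => rcons_tuple p.1.1 p.1.2).
      by apply: measurable_rcons; exact: measurableT_comp.
    have mg2 : measurable_fun setT (fun p : (n.-tuple T * T) * T => rcons_tuple p.1.1 p.2).
      by apply: measurable_rcons => //; exact: measurableT_comp.
    have b1 := bounded_pos_mfun_comp _ _ _ _ _ _ mg1 bh.
    have b2 := bounded_pos_mfun_comp _ _ _ _ _ _ mg2 bh.
    have b1' := bounded_pos_mfunW _ _ _ b1.
    have b2' := bounded_pos_mfunW _ _ _ b2.
    have lb1 := bounded_pos_mfun_ln _ _ _ b1.
    have lb2 := bounded_pos_mfun_ln _ _ _ b2.
    apply: bounded_mfunD => //; apply: bounded_mfunB => //.
    by apply: bounded_mfunM => //; exact: bounded_mfunB.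
  have bK2 := bounded_mfun_Rintegral_y _ _ _ _ (power_prob n \x D)%E D _ bK.
  have bK1 := bounded_mfun_Rintegral_y _ _ _ _ (power_prob n) D _ bK2.
  under [leRHS]eq_integral => y _.
    under eq_integral => t _.
      rewrite EFin_Rintegral; last exact: (bounded_mfun_x _ _ _ _ _ (y, t) bK).
      over.
    rewrite EFin_Rintegral; last exact: (bounded_mfun_x _ _ _ _ _ y bK2).
    over.
  apply: ge0_le_integral => //.
  + move=> y _; rewrite lee_fin entropy_ge0//.
    exact: (bounded_pos_mfun_x _ _ _ _ _ _ bhr).
  + by apply/measurable_EFinP; case: bE2.
  + by apply/measurable_EFinP; case: bK1.
  + move=> y _; rewrite lee_fin; apply: entropy_le_kl.
    exact: (bounded_pos_mfun_x _ _ _ _ _ _ bhr).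
Qed.

(** Tonelli moves [alpha] inside the data integrals. There the two tuples differ only in the
    resampled point, so the hypothesis bounds each divergence by [c], and averaging over
    probabilities keeps the bound. *)
Lemma integral_klsum_le n d0 (A : measurableType d0) (alpha : probability A R)
    (h : A * n.-tuple T -> R) (c : R) :
  measurable_fun setT h -> (forall x, 0 < h x) ->
  (forall x y, neighbor x y -> \int[alpha]_a (kl (h (a, x)) (h (a, y)))%:E <= c%:E)%E ->
  (\int[alpha]_a klsum n (fun x => h (a, x)) <= (n%:R * c)%:E)%E.
Proof.
elim: n h => [|n IH] h mh h0 hc /=.
  by rewrite integral0_eq// mul0r.
have m1 : measurable_fun setT (fun p : A * T => klsum n (fun y => h (p.1, rcons_tuple y p.2))).
  apply: (measurable_klsum n _ (A * T)%type (fun q => h (q.1.1, rcons_tuple q.2 q.1.2))) => //.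
  apply: (measurableT_comp mh); apply: measurable_fun_pair => //=.
    exact: measurableT_comp.
  by apply: measurable_rcons => //; exact: measurableT_comp.
have m4 := measurable_klsum_tail n _ _ h mh.
have m3 := measurable_fun_fubini_tonelli_F (m2 := D) _ m4.
have {}m3 := m3 (fun p => ltac:(by rewrite lee_fin kl_ge0)).
have m2 := measurable_fun_fubini_tonelli_F (m2 := D) _ m3.
have {}m2 := m2 (fun p => ltac:(by apply: integral_ge0 => ? _; rewrite lee_fin kl_ge0)).
have m2' := measurable_fun_fubini_tonelli_F (m2 := power_prob n) _ m2.
have {}m2' := m2' (fun p => ltac:(by do 2 (apply: integral_ge0 => ? _); rewrite lee_fin kl_ge0)).
rewrite ge0_integralD//; first last.
- by move=> a _; do 3 (apply: integral_ge0 => ? _); rewrite lee_fin kl_ge0.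
- apply: (measurable_fun_fubini_tonelli_F (m2 := D) _ m1).
  by move=> p; exact: klsum_ge0.
- by move=> a _; apply: integral_ge0 => t _; exact: klsum_ge0.
rewrite -natr1 mulrDl mul1r EFinD; apply: leeD.
  rewrite (fubini_tonelli (fun p : A * T =>
    klsum n (fun y => h (p.1, rcons_tuple y p.2)))) //=; last first.
    by move=> p; exact: klsum_ge0.
  apply: integral_probability_le => //.
  + apply: (measurable_fun_fubini_tonelli_G (m1 := alpha) _ m1).
    by move=> p; exact: klsum_ge0.
  + by move=> t; apply: integral_ge0 => a _; exact: klsum_ge0.
  + move=> t; apply: (IH (fun q => h (q.1, rcons_tuple q.2 t))) => //.
      apply: (measurableT_comp mh); apply: measurable_fun_pair => //=.
      exact: measurable_rcons.
    by move=> x y xy; exact: (hc _ _ (neighbor_rcons_l _ _ t xy)).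
rewrite (fubini_tonelli (fun p : A * n.-tuple T => \int[D]_t \int[D]_u
  (kl (h (p.1, rcons_tuple p.2 t)) (h (p.1, rcons_tuple p.2 u)))%:E)%E) //=; last first.
  by move=> p; do 2 (apply: integral_ge0 => ? _); rewrite lee_fin kl_ge0.
apply: integral_probability_le => //.
- apply: (measurable_fun_fubini_tonelli_G (m1 := alpha) _ m2).
  by move=> p; do 2 (apply: integral_ge0 => ? _); rewrite lee_fin kl_ge0.
- by move=> y; do 3 (apply: integral_ge0 => ? _); rewrite lee_fin kl_ge0.
move=> y.
have my : measurable_fun setT (fun p : A * T => ((p.1, y), p.2)).
  by apply: measurable_fun_pair => //; exact: measurable_fun_pair.
have m3y : measurable_fun setT (fun p : A * T => \int[D]_u
    (kl (h (p.1, rcons_tuple y p.2)) (h (p.1, rcons_tuple y u)))%:E)%E.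
  exact: (measurableT_comp m3 my).
rewrite (fubini_tonelli _ m3y)//=; last first.
  by move=> p; apply: integral_ge0 => ? _; rewrite lee_fin kl_ge0.
apply: integral_probability_le => //.
- apply: (measurable_fun_fubini_tonelli_G (m1 := alpha) _ m3y).
  by move=> p; apply: integral_ge0 => ? _; rewrite lee_fin kl_ge0.
- by move=> t; do 2 (apply: integral_ge0 => ? _); rewrite lee_fin kl_ge0.
move=> t.
have mt : measurable_fun setT (fun p : A * T => (((p.1, y), t), p.2)).
  by do 2 (apply: measurable_fun_pair => //); exact: measurable_fun_pair.
have m4t : measurable_fun setT (fun p : A * T =>
    (kl (h (p.1, rcons_tuple y t)) (h (p.1, rcons_tuple y p.2)))%:E)%E.
  exact: (measurableT_comp m4 mt).
rewrite (fubini_tonelli _ m4t)//=; last by move=> p; rewrite lee_fin kl_ge0.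
apply: integral_probability_le => //.
- apply: (measurable_fun_fubini_tonelli_G (m1 := alpha) _ m4t).
  by move=> p; rewrite lee_fin kl_ge0.
- by move=> u; apply: integral_ge0 => ? _; rewrite lee_fin kl_ge0.
by move=> u; apply: hc; exact: neighbor_rcons_r.
Qed.

End power_measure.

(** * Squared deviations of a fixed query *)

Section subgaussian.
Context {R : realType} {d} {T : measurableType d}.
Variable D : probability T R.

Lemma bounded_mfun01 (phi : T -> R) : measurable_fun setT phi ->
  (forall t, 0 <= phi t <= 1) -> bounded_mfun phi.
Proof.
move=> mphi phi01; split => //; exists 1 => t.
by have /andP[p0 p1] := phi01 t; rewrite ger0_norm.
Qed.

Lemma popmean01 (phi : T -> R) : measurable_fun setT phi ->
  (forall t, 0 <= phi t <= 1) -> 0 <= popmean D phi <= 1.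
Proof.
move=> mphi phi01.
exact: (bRintegral_bound _ _ D _ _ _ (bounded_mfun01 phi mphi phi01)).
Qed.

(** Convexity replaces the exponential by its chord over [0, 1], whose mean depends on [phi] only
    through [p]; this is the two-point case. *)
Lemma hoeffding_lemma (phi : T -> R) (s : R) : measurable_fun setT phi ->
  (forall t, 0 <= phi t <= 1) ->
  (\int[D]_t (expR (s * (phi t - popmean D phi)))%:E <= (expR (s ^+ 2 / 8))%:E)%E.
Proof.
move=> mphi phi01.
have bphi := bounded_mfun01 phi mphi phi01.
have p01 := popmean01 phi mphi phi01.
set p := popmean D phi in p01 *.
have b1 : bounded_mfun (fun t => expR (s * (phi t - p))).
  apply: bounded_mfun_expR; apply: bounded_mfunM; first exact: bounded_mfun_cst.
  by apply: bounded_mfunB => //; exact: bounded_mfun_cst.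
rewrite EFin_Rintegral// lee_fin.
apply: le_trans (hoeffding_two_point p s p01).
have b2 : bounded_mfun (fun t => phi t * (expR s - 1)).
  by apply: bounded_mfunM => //; exact: bounded_mfun_cst.
have b3 : bounded_mfun (fun t => 1 + phi t * (expR s - 1)).
  by apply: bounded_mfunD => //; exact: bounded_mfun_cst.
have -> : (1 - p + p * expR s) * expR (- (p * s)) =
    \int[D]_t ((1 + phi t * (expR s - 1)) * expR (- (p * s))).
  rewrite bRintegralZr// bRintegralD//; last exact: bounded_mfun_cst.
  rewrite Rintegral_cst_probability bRintegralZr//.
  by have -> : \int[D]_t phi t = p by []; ring.
apply: le_bRintegral => //.
  by apply: bounded_mfunM => //; exact: bounded_mfun_cst.
move=> t; rewrite mulrBr expRD (mulrC s p) ler_pM2r ?expR_gt0//.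
by have := expR_convex01 s _ (phi01 t); lra.
Qed.

Lemma measurable_sum_tnth n (phi : T -> R) (p : R) : measurable_fun setT phi ->
  measurable_fun setT (fun x : n.-tuple T => \sum_(j < n) (phi (tnth x j) - p)).
Proof.
move=> mphi; apply: measurable_sum => j; apply: measurable_funB => //.
exact: (measurableT_comp mphi (measurable_tnth j)).
Qed.

Lemma sum_tnth_rcons n (phi : T -> R) (y : n.-tuple T) t :
  \sum_(j < n.+1) phi (tnth (rcons_tuple y t) j) = \sum_(j < n) phi (tnth y j) + phi t.
Proof.
rewrite big_ord_recr /= tnth_rcons_max; congr (_ + _).
by apply: eq_bigr => j _; rewrite tnth_rcons_widen.
Qed.

Lemma hoeffding_power n (phi : T -> R) (s : R) : measurable_fun setT phi ->
  (forall t, 0 <= phi t <= 1) ->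
  (\int[power_prob D n]_x (expR (s * \sum_(j < n) (phi (tnth x j) - popmean D phi)))%:E
    <= (expR (n%:R * (s ^+ 2 / 8)))%:E)%E.
Proof.
move=> mphi phi01; set p := popmean D phi.
have mexp k : measurable_fun setT (fun x : k.-tuple T =>
    (expR (s * \sum_(j < k) (phi (tnth x j) - p)))%:E).
  apply/measurable_EFinP; apply: measurableT_comp => //.
  by apply: measurable_funM => //; exact: measurable_sum_tnth.
elim: n => [|n IH].
  by rewrite ge0_integral_power0// big_ord0 mulr0 mul0r.
rewrite ge0_integral_powerS//.
rewrite -natr1 mulrDl mul1r expRD EFinM.
apply: (@le_trans _ _ (\int[power_prob D n]_y
   ((expR (s * \sum_(j < n) (phi (tnth y j) - p)))%:E * (expR (s ^+ 2 / 8))%:E))%E).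
  apply: ge0_le_integral => //.
  - by move=> y _; apply: integral_ge0 => t _; rewrite lee_fin expR_ge0.
  - apply: (@measurable_fun_fubini_tonelli_F _ _ _ _ R D (fun p0 =>
      (expR (s * \sum_(j < n.+1) (phi (tnth (rcons_pair n p0) j) - p)))%:E)).
      exact: (measurableT_comp (mexp n.+1) (measurable_rcons_pair n)).
    by move=> x; rewrite lee_fin expR_ge0.
  - by apply: emeasurable_funM => //; exact: mexp.
  - move=> y _.
    under eq_integral => t _.
      rewrite (sum_tnth_rcons _ (fun t => phi t - p)) mulrDr expRD EFinM; over.
    rewrite ge0_integralZl//.
    + by apply: lee_wpmul2l; [rewrite lee_fin expR_ge0|exact: hoeffding_lemma].
    + apply/measurable_EFinP; apply: measurableT_comp => //.
      by apply: measurable_funM => //; exact: measurable_funB.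
by rewrite ge0_integralZr//; [rewrite lee_wpmul2r// lee_fin expR_ge0|exact: mexp].
Qed.

(* Writing [exp (c ^ 2 / 2)] as the Gaussian average of [exp (c g)] turns the
   square into a linear exponent, to which Hoeffding applies. *)
Lemma subgaussian_sqr n (phi : T -> R) (l : R) : (0 < n)%N -> 0 < l < 1 ->
  measurable_fun setT phi -> (forall t, 0 <= phi t <= 1) ->
  (\int[power_prob D n]_x
     (expR (2 * n%:R * l * (popmean D phi - empmean phi (tnth x)) ^+ 2))%:E
    <= ((Num.sqrt (1 - l))^-1)%:E)%E.
Proof.
move=> n0 l01 mphi phi01; set p := popmean D phi.
have n0' : 0 < n%:R :> R by rewrite ltr0n.
have [l0 l1] := andP l01.
(* Chosen so that [(c Y)^2 / 2 = 2 n l (Y / n)^2]; Hoeffding then yields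
   [n (c g)^2 / 8 = l g^2 / 2]. *)
pose c := 2 * Num.sqrt (l / n%:R).
have c2 : c ^+ 2 = 4 * (l / n%:R).
  by rewrite exprMn sqr_sqrtr ?divr_ge0 ?ltW//; ring.
pose Y (x : n.-tuple T) := \sum_(j < n) (phi (tnth x j) - p).
have mY : measurable_fun setT Y by exact: measurable_sum_tnth.
have YE x : p - empmean phi (tnth x) = - (n%:R^-1 * Y x).
  rewrite /Y /empmean sumrB sumr_const card_ord -mulr_natl.
  by field; rewrite gt_eqF.
have E x : expR (2 * n%:R * l * (p - empmean phi (tnth x)) ^+ 2) = expR ((c * Y x) ^+ 2 / 2).
  congr expR; rewrite YE exprMn c2 sqrrN; field.
  by rewrite gt_eqF.
under eq_integral => x _ do rewrite E -integral_normal_expR.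
have mF : measurable_fun setT (fun q : n.-tuple T * R => (expR (c * Y q.1 * q.2))%:E).
  apply/measurable_EFinP; apply: measurableT_comp => //; apply: measurable_funM => //.
  by apply: measurable_funM => //; exact: measurableT_comp.
have := @fubini_tonelli _ _ _ _ R (power_prob D n) (normal_prob 0 1) _ mF
  (fun x => ltac:(by rewrite lee_fin expR_ge0)).
move=> /= /eqP; rewrite eq_le => /andP[/le_trans + _]; apply.
rewrite -integral_normal_expR_sqr//; apply: ge0_le_integral => //.
- by move=> g _; apply: integral_ge0 => x _; rewrite lee_fin expR_ge0.
- apply: (measurable_fun_fubini_tonelli_G _ mF).
  by move=> x; rewrite lee_fin expR_ge0.
- apply/measurable_EFinP; apply: measurableT_comp => //; apply: measurable_funM => //.
  by apply: measurable_funM => //; exact: measurable_funX.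
move=> g _.
under eq_integral do rewrite mulrAC.
apply: le_trans (hoeffding_power _ _ (c * g) mphi phi01) _.
rewrite lee_fin ler_expR exprMn c2 le_eqVlt; apply/orP; left; apply/eqP.
by field; rewrite gt_eqF.
Qed.

End subgaussian.

(** * The adaptive Gaussian mechanism *)

Lemma bounded_pos_mfun_expR {R : realType} d (T : measurableType d) (f : T -> R) :
  bounded_mfun f -> bounded_pos_mfun (fun x => expR (f x)).
Proof.
move=> [mf [M fM]]; split; first exact: measurableT_comp.
exists (expR (- M)), (expR M); split; first exact: expR_gt0.
by move=> x; rewrite !ler_expR -ler_norml.
Qed.

Lemma bounded_pos_mfunM {R : realType} d (T : measurableType d) (f g : T -> R) :
  bounded_pos_mfun f -> bounded_pos_mfun g -> bounded_pos_mfun (fun x => f x * g x).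
Proof.
move=> bf bg; have f0 x := bounded_pos_mfun_gt0 _ _ _ x bf.
have g0 x := bounded_pos_mfun_gt0 _ _ _ x bg.
case: bf bg => mf [c [C [c0 fC]]] [mg [e [E [e0 gE]]]].
split; first exact: measurable_funM.
exists (c * e), (C * E); split; first exact: mulr_gt0.
move=> x; have /andP[cf fC'] := fC x; have /andP[eg gE'] := gE x.
by rewrite !ler_pM// ltW.
Qed.

Section gauss.
Context {R : realType}.

Definition borel_id (x : measurableTypeR R) : R := x.

Lemma measurable_borel_id : measurable_fun [set: measurableTypeR R] borel_id.
Proof. by move=> _ A mA; rewrite setTI. Qed.

HB.instance Definition _ := isMeasurableFun.Build _ _ _ _ borel_id measurable_borel_id.

(* [normal_prob] lives on [measurableTypeR R], whose display differs from the
   one of the canonical measurable structure of [R]. *)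
Definition gauss (s : R) : probability R R := distribution (normal_prob 0 s) borel_id.

Lemma ge0_integral_gauss s (F : R -> \bar R) : measurable_fun setT F ->
  (forall x, 0 <= F x)%E ->
  (\int[gauss s]_x F x = \int[normal_prob 0 s]_x F x)%E.
Proof. by move=> mF F0; rewrite ge0_integral_distribution. Qed.

End gauss.

Section mechanism.
Context {R : realType} {dT dS : measure_display}
  {T : measurableType dT} {S : measurableType dS}.
Variables (n : nat) (s : R) (D : probability T R).
Variable analyst : forall i : nat, S -> i.-tuple R -> T -> R.
Hypothesis s0 : s != 0.
Hypothesis n0 : (0 < n)%N.
Hypothesis analyst01 : forall i u h t, 0 <= analyst i u h t <= 1.
Hypothesis manalyst : forall i, measurable_fun [set: (S * i.-tuple R) * T]
               (fun p => analyst i p.1.1 p.1.2 p.2).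

Definition mean i u (x : n.-tuple T) (a : i.-tuple R) : R :=
  empmean (analyst i u a) (tnth x).

Definition pmean i u (a : i.-tuple R) : R := popmean D (analyst i u a).

Lemma mean01 i u x a : 0 <= mean i u x a <= 1.
Proof.
have n0' : 0 < n%:R :> R by rewrite ltr0n.
rewrite /mean /empmean; apply/andP; split.
  rewrite mulr_ge0 ?invr_ge0 ?ler0n// sumr_ge0// => j _.
  by have /andP[] := analyst01 i u a (tnth x j).
rewrite ler_pdivrMl// mulr1 -[leRHS]mulr1 mulr_natl.
have -> : (1 : R) *+ n = \sum_(j < n) 1 by rewrite sumr_const card_ord.
by apply: ler_sum => j _; have /andP[] := analyst01 i u a (tnth x j).
Qed.

Lemma measurable_analyst i u a : measurable_fun setT (analyst i u a).
Proof.
apply: (measurableT_comp (manalyst i) (_ : measurable_fun setT (fun t => ((u, a), t)))).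
exact: measurable_fun_pair.
Qed.

Section measurability.
Context d0 (A : measurableType d0).
Variables (fu : A -> S) (fx : A -> n.-tuple T).
Hypotheses (mfu : measurable_fun setT fu) (mfx : measurable_fun setT fx).

Lemma measurable_mean i (fa : A -> i.-tuple R) : measurable_fun setT fa ->
  measurable_fun setT (fun w => mean i (fu w) (fx w) (fa w)).
Proof.
move=> mfa; apply: measurable_funM => //; apply: measurable_sum => j.
apply: (measurableT_comp (manalyst i)
  (_ : measurable_fun setT (fun w => ((fu w, fa w), tnth (fx w) j)))).
apply: measurable_fun_pair; first exact: measurable_fun_pair.
exact: (measurableT_comp (measurable_tnth j)).
Qed.

Lemma measurable_pmean i (fa : A -> i.-tuple R) : measurable_fun setT fa ->
  measurable_fun setT (fun w => pmean i (fu w) (fa w)).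
Proof.
move=> mfa; apply: (measurableT_comp (@fine_measurable R setT measurableT)) => //.
apply: (@measurable_fun_fubini_tonelli_F _ _ A T R D
  (fun q => (analyst i (fu q.1) (fa q.1) q.2)%:E)).
  apply/measurable_EFinP.
  apply: (measurableT_comp (manalyst i)
    (_ : measurable_fun setT (fun q : A * T => ((fu q.1, fa q.1), q.2)))).
  apply: measurable_fun_pair => //.
  by apply: measurable_fun_pair; exact: measurableT_comp.
by move=> q; rewrite lee_fin; have /andP[] := analyst01 i (fu q.1) (fa q.1) q.2.
Qed.

End measurability.

(* Density of the answers given the data, relative to pure noise. *)
Fixpoint likelihood k (u : S) (x : n.-tuple T) : k.-tuple R -> R :=
  match k with
  | 0 => fun _ => 1
  | i.+1 => fun b => likelihood i u x (tinit b) *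
      gshift s (tlast b) (mean i u x (tinit b))
  end.

(** Here [b] is a noise vector, whereas in [likelihood] it is a vector of answers. *)
Fixpoint answers k (u : S) (x : n.-tuple T) : k.-tuple R -> k.-tuple R :=
  match k with
  | 0 => fun b => b
  | i.+1 => fun b => let h := answers i u x (tinit b) in
      rcons_tuple h (mean i u x h + tlast b)
  end.

Lemma likelihood_gt0 k u x a : 0 < likelihood k u x a.
Proof.
by elim: k a => [//|k IH] a /=; rewrite mulr_gt0// gshift_gt0.
Qed.

Lemma likelihood_rcons k u x a z :
  likelihood k.+1 u x (rcons_tuple a z) = likelihood k u x a * gshift s z (mean k u x a).
Proof. by rewrite /= tinit_rcons tlast_rcons. Qed.

Lemma answers_rcons k u x a z : answers k.+1 u x (rcons_tuple a z) =
  rcons_tuple (answers k u x a) (z + mean k u x (answers k u x a)).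
Proof. by rewrite /= tinit_rcons tlast_rcons addrC. Qed.

Lemma measurable_gshift2 d0 (A : measurableType d0) (f g : A -> R) :
  measurable_fun setT f -> measurable_fun setT g ->
  measurable_fun setT (fun w => gshift s (f w) (g w)).
Proof.
move=> mf mg; apply: measurableT_comp => //; apply: measurable_funM => //.
apply: measurable_funB; first exact: measurable_funM.
by apply: measurable_funM => //; exact: measurable_funX.
Qed.

Lemma measurable_likelihood k d0 (A : measurableType d0) fu fx (fa : A -> k.-tuple R) :
  measurable_fun setT fu -> measurable_fun setT fx -> measurable_fun setT fa ->
  measurable_fun setT (fun w => likelihood k (fu w) (fx w) (fa w)).
Proof.
move=> mfu mfx; elim: k fa => [|k IH] fa mfa /=; first exact: measurable_cst.
have mi := measurable_tinit _ _ _ _ _ _ mfa.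
apply: measurable_funM; first exact: IH.
apply: measurable_gshift2; first exact: measurable_tlast.
exact: measurable_mean.
Qed.

Lemma measurable_answers k d0 (A : measurableType d0) fu fx (fa : A -> k.-tuple R) :
  measurable_fun setT fu -> measurable_fun setT fx -> measurable_fun setT fa ->
  measurable_fun setT (fun w => answers k (fu w) (fx w) (fa w)).
Proof.
move=> mfu mfx; elim: k fa => [|k IH] fa mfa //=.
have mi := IH _ (measurable_tinit _ _ _ _ _ _ mfa).
apply: measurable_rcons => //; apply: measurable_funD; first exact: measurable_mean.
exact: measurable_tlast.
Qed.

(** The bounds depend on [a]: the exponent of [gshift] is linear in the answer, while the mean stays
    in [0, 1]. The entropy inequalities are applied at fixed [a]. *)
Lemma bounded_likelihood k u a : bounded_pos_mfun (fun x => likelihood k u x a).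
Proof.
elim: k a => [|k IH] a /=.
  by split => //; exists 1, 1; split => // _; rewrite lexx.
apply: bounded_pos_mfunM => //; apply: bounded_pos_mfun_expR.
have bm : bounded_mfun (fun x => mean k u x (tinit a)).
  split; first exact: measurable_mean.
  exists 1 => x; have /andP[m0 m1] := mean01 k u x (tinit a).
  by rewrite ger0_norm.
apply: bounded_mfunM; last exact: bounded_mfun_cst.
apply: bounded_mfunB; first by apply: bounded_mfunM => //; exact: bounded_mfun_cst.
by apply: bounded_mfunM => //; [exact: bounded_mfunM|exact: bounded_mfun_cst].
Qed.

(** Given the past, an answer is fresh noise shifted by an already determined mean, so each round
    costs one factor [gshift]. *)
Lemma integral_answers k u x (F : k.-tuple R -> \bar R) :
  measurable_fun setT F -> (forall a, 0 <= F a)%E ->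
  (\int[power_prob (gauss s) k]_z F (answers k u x z) =
   \int[power_prob (gauss s) k]_a (F a * (likelihood k u x a)%:E))%E.
Proof.
elim: k F => [|k IH] F mF F0.
  rewrite /= !integral_dirac//=; first by rewrite mule1.
  by apply: emeasurable_funM => //; exact: measurable_cst.
have ma : measurable_fun setT (answers k.+1 u x) by exact: measurable_answers.
have mFa : measurable_fun setT (fun z => F (answers k.+1 u x z)).
  exact: (measurableT_comp mF).
rewrite ge0_integral_powerS//.
have ml : measurable_fun setT (likelihood k.+1 u x) by exact: measurable_likelihood.
have l0 (a : k.+1.-tuple R) : (0 <= (likelihood k.+1 u x a)%:E)%E.
  by rewrite lee_fin ltW// likelihood_gt0.
rewrite ge0_integral_powerS; last 2 first.
- by apply: emeasurable_funM => //; exact/measurable_EFinP.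
- by move=> a; rewrite mule_ge0.
have mFr (a : k.-tuple R) : measurable_fun setT (fun z : R => F (rcons_tuple a z)).
  by apply: (measurableT_comp mF); exact: measurable_rcons.
(* [G] carries the factor of the last round; integrating out the last answer leaves a function of
   the past answers, to which the induction hypothesis applies. *)
pose G (q : k.-tuple R * R) := (F (rcons_tuple q.1 q.2) * (gshift s q.2 (mean k u x q.1))%:E)%E.
have mG : measurable_fun setT G.
  apply: emeasurable_funM; first by apply: (measurableT_comp mF); exact: measurable_rcons.
  apply/measurable_EFinP; apply: measurable_gshift2 => //.
  exact: measurable_mean.
have G0 q : (0 <= G q)%E by rewrite mule_ge0// lee_fin ltW// gshift_gt0.
transitivity (\int[power_prob (gauss s) k]_z
    (fun a => \int[gauss s]_y G (a, y))%E (answers k u x z))%E.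
  apply: eq_integral => z _ /=.
  have mGz : measurable_fun setT (fun y => G (answers k u x z, y)).
    by apply: (measurableT_comp mG); exact: measurable_fun_pair.
  rewrite [RHS](ge0_integral_gauss s _ mGz)//.
  rewrite -[RHS](ge0_integral_normal_shift s (mean k u x (answers k u x z))
    (fun y => F (rcons_tuple (answers k u x z) y)) s0)//.
  rewrite ge0_integral_gauss//; last first.
    by apply: (measurableT_comp mFa); exact: measurable_rcons.
  by apply: eq_integral => y _; rewrite tinit_rcons tlast_rcons addrC.
rewrite (IH (fun a => \int[gauss s]_y G (a, y))%E); last 2 first.
- exact: (measurable_fun_fubini_tonelli_F _ mG).
- by move=> a; apply: integral_ge0.
apply: eq_integral => a _.
rewrite -ge0_integralZr//; last 2 first.
- by apply: (measurableT_comp mG); exact: measurable_fun_pair.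
- by rewrite lee_fin ltW// likelihood_gt0.
apply: eq_integral => y _.
by rewrite likelihood_rcons /G -muleA -EFinM mulrC.
Qed.

Lemma integral_likelihood k u x :
  (\int[power_prob (gauss s) k]_a (likelihood k u x a)%:E = 1)%E.
Proof.
transitivity (\int[power_prob (gauss s) k]_a (cst 1 a * (likelihood k u x a)%:E))%E.
  by apply: eq_integral => a _; rewrite mul1e.
by rewrite -integral_answers//; exact: integral_cst_probability.
Qed.

Lemma mean_neighbor i u x y a : neighbor x y ->
  (mean i u x a - mean i u y a) ^+ 2 <= n%:R^-1 ^+ 2.
Proof.
move=> [j xy]; rewrite /mean /empmean -mulrBr -sumrB.
rewrite (bigD1 j)//= big1 ?addr0; last first.
  by move=> i' ij; rewrite xy// subrr.
rewrite exprMn ler_piMr ?sqr_ge0//.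
have := analyst01 i u a (tnth x j); have := analyst01 i u a (tnth y j).
set p := analyst _ _ _ _; set q := analyst _ _ _ _ => /andP[p0 p1] /andP[q0 q1].
rewrite -(expr1n _ 2) -ler_sqrt; last by rewrite expr1n.
rewrite !sqrtr_sqr normr1 ler_norml; lra.
Qed.

(** Both likelihoods are evaluated at the same answers, so both data sets face the same queries and
    the means differ by at most [1/n]. By the chain rule each round adds at most [r] times a
    likelihood of total mass 1. *)
Lemma integral_kl_likelihood k u x y : neighbor x y ->
  (\int[power_prob (gauss s) k]_a (kl (likelihood k u x a) (likelihood k u y a))%:E
   <= (k%:R * (n%:R^-1 ^+ 2 / (2 * s ^+ 2)))%:E)%E.
Proof.
move=> xy; set r := _ / _.
have mkl i : measurable_fun setT (fun a : i.-tuple R =>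
    (kl (likelihood i u x a) (likelihood i u y a))%:E).
  by apply/measurable_EFinP; apply: measurable_kl; exact: measurable_likelihood.
have kl0 i (a : i.-tuple R) : (0 <= (kl (likelihood i u x a) (likelihood i u y a))%:E)%E.
  by rewrite lee_fin kl_ge0// likelihood_gt0.
elim: k => [|k IH].
  by rewrite ge0_integral_power0//= /kl subrr mulr0 mul0r lee_fin; lra.
rewrite ge0_integral_powerS//.
have r0 : 0 <= r by rewrite divr_ge0 ?sqr_ge0// mulr_ge0// sqr_ge0.
under eq_integral => a _.
  under eq_integral do rewrite !likelihood_rcons.
  rewrite ge0_integral_gauss; last 2 first.
  - apply/measurable_EFinP; apply: measurable_kl; apply: measurable_funM => //;
      exact: measurable_gshift.
  - by move=> z; rewrite lee_fin kl_ge0// mulr_gt0// ?likelihood_gt0 ?gshift_gt0.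
  rewrite (integral_kl_gshift s _ _ _ _ s0 (likelihood_gt0 k u x a) (likelihood_gt0 k u y a)).
  over.
apply: (@le_trans _ _ (\int[power_prob (gauss s) k]_a
   ((kl (likelihood k u x a) (likelihood k u y a))%:E + r%:E * (likelihood k u x a)%:E))%E).
  apply: ge0_le_integral => //.
  - move=> a _; rewrite EFinD adde_ge0// lee_fin mulr_ge0//.
      by rewrite ltW// likelihood_gt0.
    by rewrite divr_ge0 ?sqr_ge0// mulr_ge0// sqr_ge0.
  - apply/measurable_EFinP; apply: measurable_funD.
      by apply: measurable_kl; exact: measurable_likelihood.
    apply: measurable_funM; first exact: measurable_likelihood.
    apply: measurable_funM => //; apply: measurable_funX.
    by apply: measurable_funB; exact: measurable_mean.
  - apply: emeasurable_funD; [exact: mkl|apply: emeasurable_funM => //].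
    by apply/measurable_EFinP; exact: measurable_likelihood.
  - move=> a _; rewrite -EFinM -EFinD lee_fin lerD2l mulrC.
    rewrite ler_pM2r ?likelihood_gt0//.
    rewrite ler_pM2r ?mean_neighbor//.
    by rewrite invr_gt0 mulr_gt0// exprn_even_gt0.
have ml : measurable_fun setT (fun a : k.-tuple R => (likelihood k u x a)%:E).
  by apply/measurable_EFinP; exact: measurable_likelihood.
have l0 (a : k.-tuple R) : (0 <= (likelihood k u x a)%:E)%E.
  by rewrite lee_fin ltW// likelihood_gt0.
rewrite ge0_integralD//; last 2 first.
- by move=> a _; rewrite mule_ge0.
- by apply: emeasurable_funM => //; exact: measurable_cst.
rewrite ge0_integralZl// integral_likelihood mule1.
by rewrite -natr1 mulrDl mul1r EFinD leeD2r.
exact: mkl.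
Qed.

Fixpoint max_error k (u : S) : k.-tuple R -> R :=
  match k with
  | 0 => fun _ => 0
  | i.+1 => fun b => Num.max (max_error i u (tinit b))
      ((pmean i u (tinit b) - tlast b) ^+ 2)
  end.

(* The round attaining [max_error] is determined by the answers alone; this is
   its squared generalization error on the data set [x]. *)
Fixpoint selected_gap k (u : S) (x : n.-tuple T) : k.-tuple R -> R :=
  match k with
  | 0 => fun _ => 0
  | i.+1 => fun b =>
      if max_error i u (tinit b) < (pmean i u (tinit b) - tlast b) ^+ 2
      then (pmean i u (tinit b) - mean i u x (tinit b)) ^+ 2
      else selected_gap i u x (tinit b)
  end.

(** The order of quantifiers matters: [phi] is fixed by [u] and [a] before [x], so bounds for
    non-adaptive queries apply to it. *)
Lemma selected_gapE k u a : exists phi : T -> R,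
  [/\ measurable_fun setT phi, (forall t, 0 <= phi t <= 1) &
      forall x, selected_gap k u x a = (popmean D phi - empmean phi (tnth x)) ^+ 2].
Proof.
elim: k a => [|k IH] a /=.
  exists (fun=> 0); split => //; first by move=> t; rewrite lexx ler01.
  move=> x; rewrite /popmean integral0_eq// /empmean big1// mulr0 subrr.
  by rewrite expr0n.
have [lt_e|le_e] := boolP (max_error k u (tinit a) < (pmean k u (tinit a) - tlast a) ^+ 2).
  by exists (analyst k u (tinit a)); split => //; exact: measurable_analyst.
exact: IH.
Qed.

Lemma selected_gap01 k u x a : 0 <= selected_gap k u x a <= 1.
Proof.
elim: k a => [|k IH] a /=; first by rewrite lexx ler01.
case: ifPn => // _; rewrite sqr_ge0/=.
have /andP[m0 m1] := mean01 k u x (tinit a).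
have /andP[p0 p1] : 0 <= pmean k u (tinit a) <= 1.
  by apply: popmean01 => //; exact: measurable_analyst.
rewrite -(expr1n _ 2) -ler_sqrt; last by rewrite expr1n.
rewrite !sqrtr_sqr normr1 ler_norml; lra.
Qed.

Lemma measurable_max_error k d0 (A : measurableType d0) fu (fa : A -> k.-tuple R) :
  measurable_fun setT fu -> measurable_fun setT fa ->
  measurable_fun setT (fun w => max_error k (fu w) (fa w)).
Proof.
move=> mfu; elim: k fa => [|k IH] fa mfa /=; first exact: measurable_cst.
have mi := measurable_tinit _ _ _ _ _ _ mfa.
apply: measurable_maxr; first exact: IH.
apply: measurable_funX; apply: measurable_funB; first exact: measurable_pmean.
exact: measurable_tlast.
Qed.

Lemma measurable_selected_gap k d0 (A : measurableType d0) fu fx (fa : A -> k.-tuple R) :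
  measurable_fun setT fu -> measurable_fun setT fx -> measurable_fun setT fa ->
  measurable_fun setT (fun w => selected_gap k (fu w) (fx w) (fa w)).
Proof.
move=> mfu mfx; elim: k fa => [|k IH] fa mfa /=; first exact: measurable_cst.
have mi := measurable_tinit _ _ _ _ _ _ mfa.
have mp := measurable_pmean _ _ _ mfu _ _ mi.
apply: measurable_fun_ifT.
- apply: measurable_fun_ltr; first exact: measurable_max_error.
  apply: measurable_funX; apply: measurable_funB => //.
  exact: measurable_tlast.
- apply: measurable_funX; apply: measurable_funB => //.
  exact: measurable_mean.
- exact: IH.
Qed.

Lemma max_error_le k u x (z : k.-tuple R) :
  max_error k u (answers k u x z) <=
  2 * selected_gap k u x (answers k u x z) + 2 * \big[Num.max/0]_(i < k) (tnth z i) ^+ 2.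
Proof.
elim: k z => [|k IH] z; first by rewrite big_ord0 /=; lra.
rewrite -(rcons_tinit_tlast z); move: (tinit z) (tlast z) => {}z t.
rewrite answers_rcons /= tinit_rcons tlast_rcons.
have Mle : \big[Num.max/0]_(i < k) (tnth z i) ^+ 2 <=
    \big[Num.max/0]_(i < k.+1) (tnth (rcons_tuple z t) i) ^+ 2.
  apply: bigmax_le => [|i _]; first exact: bigmax_ge_id.
  apply: (bigmax_sup (widen_ord (leqnSn k) i)) => //.
  by rewrite tnth_rcons_widen.
have tle : t ^+ 2 <= \big[Num.max/0]_(i < k.+1) (tnth (rcons_tuple z t) i) ^+ 2.
  by apply: (bigmax_sup ord_max) => //; rewrite tnth_rcons_max.
have := IH z; move: Mle tle.
set M := \big[_/_]_(i < k) _; set M' := \big[_/_]_(i < k.+1) _.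
set e := max_error _ _ _; set p := pmean _ _ _; set m := mean _ _ _ _.
set g := selected_gap _ _ _ _ => MM' tM' eg.
case: ltP => [lt_e|le_e]; last lra.
(* The identity [(A - t)^2 = 2 A^2 + 2 t^2 - (A + t)^2] with [A = p - m]; the factor 2 before the
   noise term of the theorem comes from here. *)
have -> : (p - (t + m)) ^+ 2 = 2 * (p - m) ^+ 2 + 2 * t ^+ 2 - (p - m + t) ^+ 2 by ring.
have := sqr_ge0 (p - m + t); lra.
Qed.

Lemma integral_selected_gap_le k u (l : R) : 0 < l < 1 ->
  (\int[power_prob (gauss s) k]_a \int[power_prob D n]_x
      (likelihood k u x a * (2 * n%:R * l * selected_gap k u x a))%:E
   <= (n%:R * (k%:R * (n%:R^-1 ^+ 2 / (2 * s ^+ 2))) + ln (Num.sqrt (1 - l))^-1)%:E)%E.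
Proof.
move=> l01; have [l0 l1] := andP l01.
set r := _ / _; set C := (Num.sqrt (1 - l))^-1.
have q0 : 0 < Num.sqrt (1 - l) by rewrite sqrtr_gt0 subr_gt0.
have C0 : 0 < C by rewrite invr_gt0.
(* Ensures [ln C >= 0], so that the two terms of the bound can be integrated over [a] separately as
   nonnegative functions. *)
have C1 : 1 <= C.
  by rewrite invf_ge1// -[leRHS]sqrtr1 ler_sqrt//; lra.
have lnC0 : 0 <= ln C by exact: ln_ge0.
pose h (q : k.-tuple R * n.-tuple T) := likelihood k u q.2 q.1.
have mh : measurable_fun setT h by exact: measurable_likelihood.
have h0 q : 0 < h q by exact: likelihood_gt0.
have bgap a : bounded_mfun (fun x => 2 * n%:R * l * selected_gap k u x a).
  apply: bounded_mfunM; first exact: bounded_mfun_cst.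
  split; first exact: measurable_selected_gap.
  exists 1 => x; have /andP[g0 g1] := selected_gap01 k u x a.
  by rewrite ger0_norm.
have bL a : bounded_pos_mfun (fun x => h (a, x)) by exact: bounded_likelihood.
have mh' : measurable_fun setT (fun q => (h q)%:E) by exact/measurable_EFinP.
have h0' q : (0 <= (h q)%:E)%E by rewrite lee_fin ltW.
have mI : measurable_fun setT (fun a => \int[power_prob D n]_x (h (a, x))%:E)%E.
  exact: (measurable_fun_fubini_tonelli_F _ mh').
have mK : measurable_fun setT (fun a => klsum D n (fun x => h (a, x))).
  exact: measurable_klsum.
apply: (@le_trans _ _ (\int[power_prob (gauss s) k]_a
   (klsum D n (fun x => h (a, x)) + (ln C)%:E * \int[power_prob D n]_x (h (a, x))%:E))%E).
  apply: ge0_le_integral => //.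
  - move=> a _; apply: integral_ge0 => x _; rewrite lee_fin mulr_ge0//.
      by rewrite ltW// likelihood_gt0.
    have /andP[g0 _] := selected_gap01 k u x a.
    by rewrite !mulr_ge0// ltW.
  - apply: (@measurable_fun_fubini_tonelli_F _ _ _ _ R (power_prob D n) (fun q =>
      (likelihood k u q.2 q.1 * (2 * n%:R * l * selected_gap k u q.2 q.1))%:E)).
      apply/measurable_EFinP; apply: measurable_funM => //.
      by apply: measurable_funM => //; exact: measurable_selected_gap.
    move=> q; rewrite lee_fin mulr_ge0//; first by rewrite ltW// likelihood_gt0.
    have /andP[g0 _] := selected_gap01 k u q.2 q.1.
    by rewrite !mulr_ge0// ltW.
  - by apply: emeasurable_funD => //; apply: emeasurable_funM.
  - move=> a _; have bL' := bounded_pos_mfunW _ _ _ (bL a).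
    rewrite [leLHS]EFin_Rintegral; last exact: bounded_mfunM.
    rewrite EFin_Rintegral//.
    apply: (@le_trans _ _ (entropy _ _ (power_prob D n) (fun x => h (a, x)) +
       (\int[power_prob D n]_x h (a, x)) * ln C)%:E).
      rewrite lee_fin.
      apply: entropy_duality; [exact: bL|exact: bgap|exact: C0|].
      have [phi [mphi phi01 gapE]] := selected_gapE k u a.
      rewrite -lee_fin -EFin_Rintegral; last exact: bounded_mfun_expR.
      under eq_integral do rewrite gapE.
      exact: subgaussian_sqr.
    rewrite EFinD EFinM muleC; apply: leeD => //.
    exact: entropy_le_klsum.
rewrite ge0_integralD//; last 3 first.
- by move=> a _; apply: klsum_ge0.
- move=> a _; apply: mule_ge0; first by rewrite lee_fin.
  exact: integral_ge0.
- by apply: emeasurable_funM.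
rewrite EFinD; apply: leeD.
  apply: integral_klsum_le => // x y xy.
  exact: integral_kl_likelihood.
rewrite ge0_integralZl//; last by move=> a _; exact: integral_ge0.
(* With the answers integrated first, the likelihood has mass 1 for every data set, so [ln C] keeps
   coefficient 1. *)
rewrite (fubini_tonelli _ mh')//=.
under eq_integral do rewrite integral_likelihood.
by rewrite integral_cst_probability mule1.
Qed.

End mechanism.

(** * Joint law of the data, the noise and the analyst's randomness *)

Section law.
Context {R : realType} {d d' : measure_display}
  {Omega : measurableType d} {E : measurableType d'}.
Variables (P : probability Omega R) (f : Omega -> E) (mf : measurable_fun setT f).

Let f_mixin := isMeasurableFun.Build _ _ _ _ f mf.
Let f_mfun : {mfun Omega >-> E} := HB.pack f f_mixin.

Definition law : probability E R := distribution P f_mfun.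

Lemma lawE A : law A = P (f @^-1` A).
Proof. by []. Qed.

Lemma ge0_integral_law (F : E -> \bar R) : measurable_fun setT F ->
  (forall y, 0 <= F y)%E -> (\int[law]_y F y = \int[P]_w F (f w))%E.
Proof. by move=> mF F0; rewrite ge0_integral_distribution. Qed.

End law.
Arguments law {R d d' Omega E} P {f} mf.

Section joint_law.
Context {R : realType} {dO dT dS : measure_display}
  {Omega : measurableType dO} {T : measurableType dT} {S : measurableType dS}.
Variables (P : probability Omega R) (D : probability T R) (n k : nat) (s : R).
Variables (X : 'I_n -> Omega -> T) (Z : nat -> Omega -> R) (U : Omega -> S).
Hypothesis mX : forall j, measurable_fun [set: Omega] (X j).
Hypothesis mZ : forall i, measurable_fun [set: Omega] (Z i).
Hypothesis mU : measurable_fun [set: Omega] U.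
Hypothesis lawX : forall j A, measurable A -> P (X j @^-1` A) = D A.
Hypothesis lawZ : forall i B, (i < k)%N -> measurable B ->
     P (Z i @^-1` B) = normal_prob 0 s B.
Hypothesis indep : mutually_independent P k X Z U.

Definition sample w : n.-tuple T := [tuple X j w | j < n].
Definition noise w : k.-tuple R := [tuple Z i w | i < k].

Lemma measurable_sample : measurable_fun setT sample.
Proof.
apply/measurable_fun_tnthP => j.
by rewrite (_ : _ \o _ = X j)//; apply/funext => w /=; rewrite tnth_mktuple.
Qed.

Lemma measurable_noise : measurable_fun setT noise.
Proof.
apply/measurable_fun_tnthP => j.
by rewrite (_ : _ \o _ = Z j)//; apply/funext => w /=; rewrite tnth_mktuple.
Qed.

Let box {d'} {V : measurableType d'} {m} (A : 'I_m -> set V) : set (m.-tuple V) :=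
  \bigcap_(j in [set: 'I_m]) ((fun x => tnth x j) @^-1` A j).

Let measurable_box d' (V : measurableType d') m (A : 'I_m -> set V) :
  (forall j, measurable (A j)) -> measurable (box A).
Proof.
move=> mA; apply: fin_bigcap_measurable => // j _.
by rewrite -[X in measurable X]setTI; exact: measurable_tnth.
Qed.

Let boxes : set (set ((S * n.-tuple T) * k.-tuple R)) :=
  [set E | exists (A : 'I_n -> set T) (B : 'I_k -> set R) (C : set S),
    [/\ forall j, measurable (A j), forall i, measurable (B i), measurable C &
        E = (C `*` box A) `*` box B]].

(** Each coordinate is measurable for the sigma-algebra generated by the boxes, hence so is the
    identity map reassembled from the coordinates. *)
Let boxes_measurable : measurable = <<s boxes >>.
Proof.
apply/seteqP; split; last first.
  apply: smallest_sub; first exact: sigma_algebra_measurable.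
  move=> _ [A [B [C [mA mB mC ->]]]].
  by apply: measurableX; [apply: measurableX => //|]; exact: measurable_box.
pose V := g_sigma_algebraType boxes.
have mbox Q : boxes Q -> measurable (Q : set V) by exact: sub_sigma_algebra.
have boxT d' (W : measurableType d') m : box (fun _ : 'I_m => [set: W]) = setT.
  by apply/seteqP; split.
have m1 : measurable_fun [set: V] (fun q : V => q.1.1).
  move=> _ C mC; rewrite setTI; apply: mbox.
  exists (fun=> setT), (fun=> setT), C; split => //.
  by rewrite !boxT; apply/seteqP; split => [[[u x] z] /=|[[u x] z] /= [[]]].
have m2 : measurable_fun [set: V] (fun q : V => q.1.2).
  apply/measurable_fun_tnthP => j _ A mA; rewrite setTI; apply: mbox.
  exists (fun i => if i == j then A else setT), (fun=> setT), setT; split => //.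
    by move=> i; case: ifPn.
  rewrite boxT; apply/seteqP; split => [[[u x] z] /= Aj|[[u x] z] /= [[_ H] _]].
    by do 2 split => //; move=> i _ /=; case: ifPn => [/eqP ->|].
  by have := H j I; rewrite /= eqxx.
have m3 : measurable_fun [set: V] (fun q : V => q.2).
  apply/measurable_fun_tnthP => j _ A mA; rewrite setTI; apply: mbox.
  exists (fun=> setT), (fun i => if i == j then A else setT), setT; split => //.
    by move=> i; case: ifPn.
  rewrite boxT; apply/seteqP; split => [[[u x] z] /= Aj|[[u x] z] /= [_ H]].
    by split => //; move=> i _ /=; case: ifPn => [/eqP ->|].
  by have := H j I; rewrite /= eqxx.
have mid : measurable_fun [set: V] (fun q : V => ((q.1.1, q.1.2), q.2)).
  by apply: measurable_fun_pair => //; exact: measurable_fun_pair.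
move=> Q mQ; have := mid measurableT _ mQ; rewrite setTI.
suff -> : (fun q : V => ((q.1.1, q.1.2), q.2)) @^-1` Q = Q by [].
by apply/seteqP; split => [[[u x] z]|[[u x] z]].
Qed.

Let prior : probability (S * n.-tuple T)%type R := (law P mU \x power_prob D n)%E.

(** Independence prescribes probabilities on boxes only. These are stable under intersection and
    generate the product sigma-algebra, so uniqueness of measures extends the equality. *)
Let joint_law (F : (S * n.-tuple T) * k.-tuple R -> \bar R) :
  measurable_fun setT F -> (forall q, 0 <= F q)%E ->
  (\int[P]_w F ((U w, sample w), noise w) =
   \int[prior \x power_prob (gauss s) k]_q F q)%E.
Proof.
move=> mF F0.
have mW : measurable_fun setT (fun w => ((U w, sample w), noise w)).
  apply: measurable_fun_pair; last exact: measurable_noise.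
  by apply: measurable_fun_pair => //; exact: measurable_sample.
rewrite -(ge0_integral_law P _ mW)//.
apply: eq_measure_integral => Q mQ _.
apply: (measure_unique boxes (fun=> setT)) => //.
- move=> _ _ [A [B [C [mA mB mC ->]]]] [A' [B' [C' [mA' mB' mC' ->]]]].
  exists (fun j => A j `&` A' j), (fun i => B i `&` B' i), (C `&` C'); split.
  + by move=> j; exact: measurableI.
  + by move=> j; exact: measurableI.
  + exact: measurableI.
  apply/seteqP; split => [[[u x] z] [[[/= Cu Ax] Bz] [[/= C'u A'x] B'z]]|].
    split; [split => //|] => j _; split; [exact: Ax|exact: A'x|exact: Bz|exact: B'z].
  move=> [[u x] z] [[/= [Cu C'u] Ax] Bz].
  have A1 j := Ax j I; have B1 j := Bz j I.
  split; split; [split => // j _; exact: (A1 j).1|move=> j _; exact: (B1 j).1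
    |split => // j _; exact: (A1 j).2|move=> j _; exact: (B1 j).2].
- move=> _; exists (fun=> setT), (fun=> setT), setT; split => //.
  by apply/seteqP; split.
- by rewrite bigcup_const//; exists 0%N.
- move=> _ [A [B [C [mA mB mC ->]]]].
  rewrite [RHS]product_measure1E; last 2 first.
  - by apply: measurableX => //; exact: measurable_box.
  - exact: measurable_box.
  rewrite [X in _ = (X * _)%E]product_measure1E//; last exact: measurable_box.
  transitivity (P (U @^-1` C) * \prod_(j < n) D (A j) * \prod_(i < k) gauss s (B i))%E;
    last first.
    by congr (_ * _ * _)%E; apply/esym; exact: power_probX.
  rewrite -muleA muleC.
  rewrite (eq_bigr (fun j => P (X j @^-1` A j))); last by move=> j _; rewrite lawX.
  rewrite [in X in (_ * X * _)%E](eq_bigr (fun i : 'I_k => P (Z i @^-1` B i))); last first.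
    by move=> i _; rewrite lawZ.
  rewrite -(indep A B C mA mB mC) [LHS]lawE.
  congr (P _); apply/seteqP; split => [w [[/= Cw Aw] Bw]|w [[/= Aw Bw] Cw]].
    split => //; split => j _ /=.
      by have := Aw j I; rewrite /= tnth_mktuple.
    by have := Bw j I; rewrite /= tnth_mktuple.
  split; [split => //|] => j _ /=; rewrite tnth_mktuple; [exact: Aw|exact: Bw].
- by move=> _; rewrite [X in (X < _)%E]probability_setT ltry.
Qed.

Lemma joint_law_iterated (F : (S * n.-tuple T) * k.-tuple R -> \bar R) :
  measurable_fun setT F -> (forall q, 0 <= F q)%E ->
  (\int[P]_w F ((U w, sample w), noise w) =
   \int[law P mU]_u \int[power_prob D n]_x \int[power_prob (gauss s) k]_z F ((u, x), z))%E.
Proof.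
move=> mF F0; rewrite joint_law//.
pose F1 p := (\int[power_prob (gauss s) k]_z F (p, z))%E.
have mF1 : measurable_fun setT F1.
  exact: (@measurable_fun_fubini_tonelli_F _ _ _ _ _ (power_prob (gauss s) k) _ mF F0).
have F10 p : (0 <= F1 p)%E by exact: integral_ge0.
rewrite (@fubini_tonelli1 _ _ _ _ _ prior (power_prob (gauss s) k) _ mF F0).
exact: (@fubini_tonelli1 _ _ _ _ _ (law P mU) (power_prob D n) _ mF1 F10).
Qed.

End joint_law.

Lemma measurable_bigmaxr {R : realType} d (A : measurableType d) (I : Type) (r : seq I)
    (f : I -> A -> R) : (forall i, measurable_fun setT (f i)) ->
  measurable_fun setT (fun w => \big[Num.max/0]_(i <- r) f i w).
Proof.
move=> mf; elim: r => [|i r IH].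
  by under eq_fun do rewrite big_nil; exact: measurable_cst.
by under eq_fun do rewrite big_cons; exact: measurable_maxr.
Qed.

(** * The transcript as a function of the seed, the data and the noise *)

Section transcript.
Context {R : realType} {dO dT dS : measure_display}
  {Omega : measurableType dO} {T : measurableType dT} {S : measurableType dS}.
Variables (n : nat) (D : probability T R)
  (analyst : forall i : nat, S -> i.-tuple R -> T -> R)
  (X : 'I_n -> Omega -> T) (Z : nat -> Omega -> R) (U : Omega -> S).

Lemma transcript_answers k w : transcript analyst X Z U k w =
  answers n analyst k (U w) (sample n X w) (noise k Z w).
Proof.
elim: k => [|k IH]; first by rewrite [RHS]tuple0.
have -> : noise k.+1 Z w = rcons_tuple (noise k Z w) (Z k w).
  apply: eq_from_tnth => i; rewrite tnth_mktuple.
  have [->|[j ->]] := ord_recrP i; first by rewrite tnth_rcons_max.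
  by rewrite tnth_rcons_widen tnth_mktuple.
rewrite answers_rcons /= IH addrC /mean.
congr (rcons_tuple _ (_ + empmean _ _)).
by apply/funext => j; rewrite tnth_mktuple.
Qed.

(** Queries and answers can both be read off the transcript and [U w], so the maximal error does not
    involve the data otherwise. *)
Lemma bigmax_transcript k w :
  \big[Num.max/0]_(i < k)
    (popmean D (query analyst X Z U i w) - answer analyst X Z U i w) ^+ 2 =
  max_error D analyst k (U w) (transcript analyst X Z U k w).
Proof.
pose F i := (popmean D (query analyst X Z U i w) - answer analyst X Z U i w) ^+ 2.
have maxS k' : max_error D analyst k'.+1 (U w) (transcript analyst X Z U k'.+1 w) =
    Num.max (max_error D analyst k' (U w) (transcript analyst X Z U k' w)) (F k').
  by rewrite /= tinit_rcons tlast_rcons.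
apply/le_anti/andP; split.
  apply: bigmax_le => [|i _].
    by elim: k => [//|k IH]; rewrite maxS le_max IH.
  elim: k i => [[]//|k IH] i; rewrite maxS le_max.
  have [->|[j ->]] := ord_recrP i; first by rewrite lexx orbT.
  by rewrite (IH j).
(* Comparing with an arbitrary upper bound [B] over natural indices avoids changing the ordinal type
   of the maximum during the induction. *)
have : forall B, 0 <= B -> (forall i, (i < k)%N -> F i <= B) ->
    max_error D analyst k (U w) (transcript analyst X Z U k w) <= B.
  elim: k => [//|k IH] B B0 FB; rewrite maxS ge_max FB// andbT.
  by apply: IH => // i ik; apply: FB; exact: ltnW.
apply => [|i ik]; first exact: bigmax_ge_id.
exact: (bigmax_sup (Ordinal ik)).
Qed.

End transcript.

Section gap.
Context {R : realType} {dO dT dS : measure_display}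
  {Omega : measurableType dO} {T : measurableType dT} {S : measurableType dS}.
Variables (P : probability Omega R) (D : probability T R) (n k : nat) (s : R)
  (analyst : forall i : nat, S -> i.-tuple R -> T -> R)
  (X : 'I_n -> Omega -> T) (Z : nat -> Omega -> R) (U : Omega -> S).
Hypotheses (n0 : (0 < n)%N) (s0 : s != 0).
Hypothesis analyst01 : forall i u h t, 0 <= analyst i u h t <= 1.
Hypothesis manalyst : forall i, measurable_fun [set: (S * i.-tuple R) * T]
               (fun p => analyst i p.1.1 p.1.2 p.2).
Hypothesis mX : forall j, measurable_fun [set: Omega] (X j).
Hypothesis mZ : forall i, measurable_fun [set: Omega] (Z i).
Hypothesis mU : measurable_fun [set: Omega] U.
Hypothesis lawX : forall j A, measurable A -> P (X j @^-1` A) = D A.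
Hypothesis lawZ : forall i B, (i < k)%N -> measurable B ->
     P (Z i @^-1` B) = normal_prob 0 s B.
Hypothesis indep : mutually_independent P k X Z U.

Lemma expectation_selected_gap_le (l : R) : 0 < l < 1 ->
  (\int[P]_w (2 * n%:R * l * selected_gap n D analyst k (U w) (sample n X w)
        (transcript analyst X Z U k w))%:E
   <= (n%:R * (k%:R * (n%:R^-1 ^+ 2 / (2 * s ^+ 2))) + ln (Num.sqrt (1 - l))^-1)%:E)%E.
Proof.
move=> l01; have [l0 l1] := andP l01.
pose g u x a := 2 * n%:R * l * selected_gap n D analyst k u x a.
have g0 u x a : 0 <= g u x a.
  have /andP[? _] := selected_gap01 n D analyst n0 analyst01 manalyst k u x a.
  by rewrite !mulr_ge0// ltW.
have mg d0 (A : measurableType d0) fu fx (fa : A -> k.-tuple R) :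
    measurable_fun setT fu -> measurable_fun setT fx -> measurable_fun setT fa ->
    measurable_fun setT (fun w => (g (fu w) (fx w) (fa w))%:E).
  move=> mfu mfx mfa; apply/measurable_EFinP; apply: measurable_funM => //.
  exact: measurable_selected_gap.
have mfst1 : measurable_fun setT (fun q : (S * n.-tuple T) * k.-tuple R => q.1.1).
  exact: measurableT_comp.
have msnd1 : measurable_fun setT (fun q : (S * n.-tuple T) * k.-tuple R => q.1.2).
  exact: measurableT_comp.
under eq_integral do rewrite transcript_answers -/(g _ _ _).
rewrite (joint_law_iterated P D n k s X Z U mX mZ mU lawX lawZ indep (fun q =>
  (g q.1.1 q.1.2 (answers n analyst k q.1.1 q.1.2 q.2))%:E)); last 2 first.
- by apply: mg => //; exact: measurable_answers.
- by move=> q; rewrite lee_fin.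
(* After the change of measure the answers are an independent variable, which permits integrating
   over the data first. *)
pose H (q : (S * n.-tuple T) * k.-tuple R) :=
  ((g q.1.1 q.1.2 q.2)%:E * (likelihood n s analyst k q.1.1 q.1.2 q.2)%:E)%E.
have H0 q : (0 <= H q)%E.
  by rewrite mule_ge0 ?lee_fin// ltW// likelihood_gt0.
have mH : measurable_fun setT H.
  apply: emeasurable_funM; first exact: mg.
  by apply/measurable_EFinP; exact: measurable_likelihood.
have HE u x : (\int[power_prob (gauss s) k]_z (g u x (answers n analyst k u x z))%:E =
    \int[power_prob (gauss s) k]_z H ((u, x), z))%E.
  apply: (integral_answers n s analyst s0 manalyst k u x (fun a => (g u x a)%:E)).
    by apply: mg => //; exact: measurable_cst.
  by move=> a; rewrite lee_fin.
rewrite [leLHS](_ : _ = \int[law P mU]_u \int[power_prob D n]_x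
    \int[power_prob (gauss s) k]_z H ((u, x), z))%E; last first.
  by apply: eq_integral => u _; apply: eq_integral => x _; exact: HE.
have mHa : measurable_fun setT (fun p => \int[power_prob (gauss s) k]_z H (p, z))%E.
  exact: (@measurable_fun_fubini_tonelli_F _ _ _ _ _ (power_prob (gauss s) k) _ mH H0).
have Ha0 p : (0 <= \int[power_prob (gauss s) k]_z H (p, z))%E by exact: integral_ge0.
(* The bound holds for each value [u] of the analyst's randomness, so averaging over [u] preserves
   it. *)
apply: integral_probability_le.
- exact: (@measurable_fun_fubini_tonelli_F _ _ _ _ _ (power_prob D n) _ mHa Ha0).
- by move=> u; apply: integral_ge0 => x _; exact: Ha0.
move=> u.
have mHu : measurable_fun setT (fun q : n.-tuple T * k.-tuple R => H ((u, q.1), q.2)).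
  apply: (measurableT_comp mH); apply: measurable_fun_pair => //.
  exact: measurable_fun_pair.
rewrite (@fubini_tonelli _ _ _ _ _ (power_prob D n) (power_prob (gauss s) k) _ mHu
  (fun=> H0 _))/=.
apply: le_trans (integral_selected_gap_le n s D analyst s0 n0 analyst01 manalyst k u l l01).
rewrite le_eqVlt; apply/orP; left; apply/eqP.
apply: eq_integral => a _; apply: eq_integral => x _.
by rewrite /H /= -EFinM mulrC.
Qed.

End gap.

Theorem mainTheorem5 (R : realType) (dO dT dS : measure_display)
  (Omega : measurableType dO) (T : measurableType dT) (S : measurableType dS)
  (P : probability Omega R) (D : probability T R)
  (n k : nat) (rho : R)
  (analyst : forall i : nat, S -> i.-tuple R -> T -> R)
  (X : 'I_n -> Omega -> T) (Z : nat -> Omega -> R) (U : Omega -> S) :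
  (0 < n)%N -> (1 <= k)%N -> 0 < rho ->
  (* queries take values in [0,1] and the analyst is jointly measurable *)
  (forall i s h t, 0 <= analyst i s h t <= 1) ->
  (forall i, measurable_fun [set: (S * i.-tuple R) * T]
               (fun p => analyst i p.1.1 p.1.2 p.2)) ->
  (* random elements *)
  (forall j, measurable_fun [set: Omega] (X j)) ->
  (forall i, measurable_fun [set: Omega] (Z i)) ->
  measurable_fun [set: Omega] U ->
  (* X ~ D^n, Z_i ~ N(0, 1/(2 n^2 rho)) i.i.d., all mutually independent *)
  (forall j A, measurable A -> P (X j @^-1` A) = D A) ->
  (forall i B, (i < k)%N -> measurable B ->
     P (Z i @^-1` B) = normal_prob 0 (Num.sqrt (2 * n%:R ^+ 2 * rho)^-1) B) ->
  mutually_independent P k X Z U ->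
  (\int[P]_w (\big[Order.max/0]_(i < k)
       (popmean D (query analyst X Z U i w) - answer analyst X Z U i w) ^+ 2)%:E
   <= ((2 * n%:R)^-1 *
        inf [set (2 * rho * k%:R * n%:R - ln (1 - l)) / l | l in `]0, 1[])%:E
      + 2%:E * \int[P]_w (\big[Order.max/0]_(i < k) (Z i w) ^+ 2)%:E)%E.
Proof.
move=> n0 _ rho0 analyst01 manalyst mX mZ mU lawX lawZ indep.
have n0' : 0 < n%:R :> R by rewrite ltr0n.
set s := Num.sqrt _ in lawZ.
have v0 : 0 < (2 * n%:R ^+ 2 * rho)^-1.
  by rewrite invr_gt0 !mulr_gt0.
have s2 : s ^+ 2 = (2 * n%:R ^+ 2 * rho)^-1 by rewrite sqr_sqrtr// ltW.
have s0 : s != 0 by rewrite gt_eqF// sqrtr_gt0.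
pose gap w := selected_gap n D analyst k (U w) (sample n X w) (transcript analyst X Z U k w).
have gap01 w : 0 <= gap w <= 1 by exact: selected_gap01.
have msample := measurable_sample n X mX.
have mtr : measurable_fun setT (transcript analyst X Z U k).
  rewrite (_ : transcript _ _ _ _ _ = fun w =>
      answers n analyst k (U w) (sample n X w) (noise k Z w)).
    by apply: measurable_answers => //; exact: measurable_noise.
  by apply/funext => w; exact: transcript_answers.
have mgap : measurable_fun setT gap by exact: measurable_selected_gap.
have bgap : bounded_mfun gap.
  split => //; exists 1 => w; have /andP[g0 g1] := gap01 w.
  by rewrite ger0_norm.
pose M w := \big[Num.max/0]_(i < k) (Z i w) ^+ 2.
have M0 w : 0 <= M w by exact: bigmax_ge_id.
have mM : measurable_fun setT M.
  by apply: measurable_bigmaxr => i; exact: measurable_funX.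
(* Separates the generalization error of the selected round from the noise, whose integral is only
   carried along. *)
have split_le : (\int[P]_w (\big[Order.max/0]_(i < k)
       (popmean D (query analyst X Z U i w) - answer analyst X Z U i w) ^+ 2)%:E <=
   \int[P]_w (2 * gap w)%:E + 2%:E * \int[P]_w (M w)%:E)%E.
  rewrite -ge0_integralZl_EFin//; last 2 first.
  - by move=> w _; rewrite lee_fin.
  - exact/measurable_EFinP.
  have g20 w : (0 <= (2 * gap w)%:E)%E.
    by rewrite lee_fin mulr_ge0//; have /andP[] := gap01 w.
  have mE1 : measurable_fun setT (fun w => (2 * gap w)%:E).
    by apply/measurable_EFinP; exact: measurable_funM.
  have mE2 : measurable_fun setT (fun w => 2%:E * (M w)%:E)%E.
    by apply: emeasurable_funM => //; exact/measurable_EFinP.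
  have E20 w : (0 <= 2%:E * (M w)%:E)%E by rewrite mule_ge0 ?lee_fin.
  rewrite -ge0_integralD//.
  apply: ge0_le_integral => //.
  - by move=> w _; rewrite lee_fin bigmax_ge_id.
  - apply/measurable_EFinP; under eq_fun do rewrite bigmax_transcript.
    exact: measurable_max_error.
  - exact: emeasurable_funD.
  - move=> w _; rewrite bigmax_transcript -EFinM -EFinD lee_fin /gap transcript_answers.
    apply: (le_trans (max_error_le n D analyst k _ _ _)).
    by rewrite lerD2l /M; under eq_bigr do rewrite tnth_mktuple.
apply: (le_trans split_le); apply: leeD => //.
have b2gap : bounded_mfun (fun w => 2 * gap w).
  by apply: bounded_mfunM => //; exact: bounded_mfun_cst.
rewrite (EFin_Rintegral _ _ P)// lee_fin.
rewrite ler_pdivlMl ?mulr_gt0//.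
apply: lb_le_inf.
  (* A lower bound passes to [inf] only for a nonempty set; [l = 1/2] is an arbitrary member of the
     interval. *)
  exists ((2 * rho * k%:R * n%:R - ln (1 - 2^-1)) / 2^-1); exists 2^-1 => //=.
  by rewrite in_itv/=; lra.
move=> _ [l /= + <-]; rewrite in_itv/= => l01.
have [l0 l1] := andP l01.
have := expectation_selected_gap_le P D n k s analyst X Z U n0 s0 analyst01
  manalyst mX mZ mU lawX lawZ indep l l01.
rewrite EFin_Rintegral; last by apply: bounded_mfunM => //; exact: bounded_mfun_cst.
rewrite lee_fin bRintegralZl// bRintegralZl// -/gap s2.
have q0 : 0 < 1 - l by rewrite subr_gt0.
have -> : ln (Num.sqrt (1 - l))^-1 = - (ln (1 - l) / 2).
  rewrite lnV ?posrE ?sqrtr_gt0//; congr (- _).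
  rewrite -[in RHS](sqr_sqrtr (ltW q0)) expr2 lnM ?posrE ?sqrtr_gt0//.
  by field.
(* The prescribed variance makes the cost [rho] per round and data point, hence [rho * k * n] in
   total. *)
have -> : n%:R * (k%:R * (n%:R^-1 ^+ 2 / (2 * (2 * n%:R ^+ 2 * rho)^-1))) = rho * k%:R * n%:R :> R.
  by field; rewrite !gt_eqF.
move=> H; rewrite ler_pdivlMr//.
set G := \int[P]_w gap w in H *; lra.
Qed.
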